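(* For every integer $m\geq 2$ there exists a constant $C_m\in(0,\infty)$ with the following properties for every integer $n\geq m+1$. (a) If $R\in(1,\infty)$ and $A\subseteq[0,R]^n$ is a Lebesgue-measurable set with density $$\frac{|A|}{R^n}\geq\Big(\frac{C_m}{\log R}\Big)^{1/(9m^2)},$$ then $A$ contains the $m+1$ vertices of a right-angled $m$-dimensional simplex of ($m$-dimensional) volume $1$. (b) If $R\in(0,\infty)$ and the $n$-cube $[0,R]^n$ is measurably colored in $r$ colors, then $$R\geq\exp\big(C_m r^{9m^2}\big)$$ is sufficient to guarantee the existence of a right-angled $m$-dimensional simplex of volume $1$ whose $m+1$ vertices are monochromatic (all belong to a single color-class). Moreover, in both parts the $m$-simplex can be chosen such that $m-1$ of its edges from the right-angled vertex are parallel to the coordinate vectors $\mathbf{e}_1,\ldots,\mathbf{e}_{m-1}$ respectively, while the remaining edge from that vertex is parallel to the linear span of $\mathbf{e}_m,\ldots,\mathbf{e}_n$.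
   Context: $|A|$ denotes the Lebesgue measure of $A$. A measurable coloring of a set $S$ in $r$ colors is a partition of $S$ into $r$ Lebesgue-measurable sets, called color-classes. A right-angled $m$-dimensional simplex is a (non-degenerate) simplex having a vertex (the right-angled vertex) such that the $m$ edges from that vertex are mutually perpendicular; its volume is its $m$-dimensional volume, i.e. the product of the lengths of these $m$ edges divided by $m!$. $\mathbf{e}_1,\ldots,\mathbf{e}_n$ is the standard basis of $\mathbb{R}^n$. *)

(* Defs.v *)
From mathcomp Require Import all_boot all_order all_algebra.
From mathcomp Require Import all_classical all_reals all_analysis.

Set Implicit Arguments.
Unset Strict Implicit.
Unset Printing Implicit Defensive.

Import Order.TTheory GRing.Theory Num.Theory.

Local Open Scope classical_set_scope.
Local Open Scope ring_scope.

(* Points of R^n are row vectors; all indices start from 0, so that the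
   vector usually written e_(j+1) is [delta_mx 0 j]. *)

Definition box (R : realType) (n : nat) (a b : 'rV[R]_n) : set 'rV[R]_n :=
  [set x | forall i, a 0 i <= x 0 i <= b 0 i].

Definition box_volume (R : realType) (n : nat) (a b : 'rV[R]_n) : R :=
  \prod_(i < n) (b 0 i - a 0 i).

Definition cube (R : realType) (n : nat) (L : R) : set 'rV[R]_n :=
  box (const_mx 0) (const_mx L).

Arguments cube {R} n L.

(* The library has Lebesgue measure on R only. On R^n we take the Lebesgue
   outer measure (infimum of the total volume over countable covers by closed
   boxes); its Caratheodory-measurable sets are the Lebesgue-measurable sets,
   on which it is Lebesgue measure. *)
Definition lebesgue_outer (R : realType) (n : nat) (X : set 'rV[R]_n) :
    \bar R :=
  ereal_inf [set v | exists a b : nat -> 'rV[R]_n,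
    [/\ forall k i, a k 0 i <= b k 0 i,
        X `<=` \bigcup_k box (a k) (b k)
      & v = (\sum_(0 <= k <oo) (box_volume (a k) (b k))%:E)%E]].

Definition lebesgue_measurable (R : realType) (n : nat) :
    set (set 'rV[R]_n) :=
  (@lebesgue_outer R n).-caratheodory.

(* Empty colour classes are allowed. *)
Definition measurable_coloring (R : realType) (n : nat) (S : set 'rV[R]_n)
    (r : nat) (P : 'I_r -> set 'rV[R]_n) : Prop :=
  [/\ forall c, lebesgue_measurable (P c),
      trivIset setT P
    & \bigcup_c P c = S].

Definition dot (R : realType) (n : nat) (u v : 'rV[R]_n) : R :=
  \sum_(i < n) u 0 i * v 0 i.

(* The norm [`|v|] on matrices is the sup norm, hence this definition. *)
Definition euclidean_length (R : realType) (n : nat) (v : 'rV[R]_n) : R :=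
  Num.sqrt (dot v v).

(* An m-dimensional simplex with a distinguished vertex p is given by p and by
   the matrix E whose m rows are the edge vectors from p; it is non-degenerate
   when these rows are linearly independent. *)
Definition simplex_vertices (R : realType) (m n : nat) (p : 'rV[R]_n)
    (E : 'M[R]_(m, n)) : set 'rV[R]_n :=
  p |` [set p + row i E | i in [set: 'I_m]].

Definition right_angled (R : realType) (m n : nat) (E : 'M[R]_(m, n)) : Prop :=
  row_free E /\ forall i j, i != j -> dot (row i E) (row j E) = 0.

Definition right_angled_volume (R : realType) (m n : nat)
    (E : 'M[R]_(m, n)) : R :=
  (\prod_(i < m) euclidean_length (row i E)) / (m`!)%:R.

(* Since the edges of a right-angled simplex are nonzero, membership in a span
   expresses parallelism. The first m - 1 edges are parallel to
   e_1, ..., e_(m-1) respectively, the last one to span(e_m, ..., e_n). *)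
Definition axis_adapted (R : realType) (m n : nat) (E : 'M[R]_(m, n)) : Prop :=
  forall i : 'I_m,
    if (i < m.-1)%N then
      exists2 j : 'I_n, j = i :> nat
        & (row i E <= (delta_mx 0 j : 'rV[R]_n))%MS
    else
      (row i E <=
         \sum_(j < n | (m.-1 <= j)%N) <<(delta_mx 0 j : 'rV[R]_n)>>)%MS.

(* Main.v *)
(* Sampling A on a randomly translated fine lattice reduces the problem to a dense
   subset A of a finite torus G; rounding lengths to the lattice is harmless because
   |A \ (A + v)| tends to 0 with v. At a given scale, a greedy choice of lengths a_1,
   ..., a_(m-1) gives a set B of many points p of A such that all p + a_i e_i belong
   to A. Since the volume is prescribed, the last edge must have length Lam = m! /
   (a_1 ... a_(m-1)); it is sought on an arc of the circle of radius Lam in the plane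
   of e_m and e_(m+1), by bounding <1_B, U 1_A> from below, where U is the average
   over the translations by the points of the arc. The curvature of the arc (van der
   Corput) makes U 1_A almost invariant under translations much shorter than Lam, and
   U is absorbed by averages over squares much larger than Lam. The energies E_s of
   the averages of 1_A over squares at the s-th scale lie between 0 and |G|, so E_s -
   E_(s+1) is small for some s. There U 1_A is close to D D 1_A with D the average
   over large squares, and <1_B, D D 1_A> = <D 1_B, D 1_A> >= |D 1_B|^2 >= |B|^2 /
   |G|. In a colouring, some class has measure at least R^n / r. *)
Require Import Defs.
From HB Require Import structures.
From mathcomp Require Import all_boot all_order all_algebra.
From mathcomp Require Import all_classical all_reals all_analysis.
From mathcomp Require Import measurable_realfun ring lra zify.

Set Implicit Arguments.
Unset Strict Implicit.
Unset Printing Implicit Defensive.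

Import Order.TTheory GRing.Theory Num.Theory.
Import numFieldNormedType.Exports.
Local Open Scope ring_scope.

(** * Square-summable functions and averages over translations *)

Section L2.
Variables (R : realType) (G : finZmodType).
Implicit Types (f g h b : G -> R) (u v w : G).

(** The prescribed volume couples the last edge to the others: the short edges come from a
    pigeonhole, so [Lam] is known only up to a factor of about [X ^ (m - 1)], where [X] bounds the
    greedy steps. The scales must be far enough apart for this uncertainty to be harmless. Shrinking
    the short edges by [b] from one scale to the next multiplies [Lam] by about [b ^ (m - 1)], and
    [b] of order [P ^ 6 * X] leaves room, between two consecutive sizes of squares, for [Lam] and
    for the powers of [P] lost on either side of it. The corners have density at least beta = 1 /
    [X ^ m], with [X] of order 1 / density. The main term beta ^ 2 has to beat the square root of an
    energy drop, so [P] and the number of scales are of order 1 / beta ^ 4 = [X ^ (4 * m)]. The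
    logarithm of the largest [Lam] is then of order [X ^ (4 * m) * log X], which the power 9 m ^ 2
    of 1 / density dominates. Only m + 1 coordinates are discretised; the others are merely carried
    along by the translation, so that no constant depends on n. *)

Definition ip f g : R := \sum_y f y * g y.
Definition nrm f : R := Num.sqrt (ip f f).

Lemma ipC f g : ip f g = ip g f.
Proof. by apply: eq_bigr => y _; rewrite mulrC. Qed.

Lemma ip_ge0 f : 0 <= ip f f.
Proof. by apply: sumr_ge0 => y _; rewrite -expr2 sqr_ge0. Qed.

Lemma nrm_ge0 f : 0 <= nrm f. Proof. exact: sqrtr_ge0. Qed.

Lemma sqr_nrm f : nrm f ^+ 2 = ip f f.
Proof. by rewrite sqr_sqrtr ?ip_ge0. Qed.

Lemma eq_ip f f' g g' : f =1 f' -> g =1 g' -> ip f g = ip f' g'.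
Proof. by move=> ff gg; apply: eq_bigr => y _; rewrite ff gg. Qed.

Lemma eq_nrm f f' : f =1 f' -> nrm f = nrm f'.
Proof. by move=> ff; rewrite /nrm (eq_ip ff ff). Qed.

Lemma ip_sumr (I : finType) f (F : I -> G -> R) :
  ip f (fun y => \sum_i F i y) = \sum_i ip f (F i).
Proof.
by rewrite /ip exchange_big /=; apply: eq_bigr => y _; rewrite mulr_sumr.
Qed.

Lemma ip_suml (I : finType) f (F : I -> G -> R) :
  ip (fun y => \sum_i F i y) f = \sum_i ip (F i) f.
Proof. by rewrite ipC ip_sumr; apply: eq_bigr => i _; rewrite ipC. Qed.

Lemma ipBr f g h : ip f (g \- h) = ip f g - ip f h.
Proof. by rewrite /ip -sumrB; apply: eq_bigr => y _ /=; rewrite mulrBr. Qed.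

Lemma ipBl f g h : ip (g \- h) f = ip g f - ip h f.
Proof. by rewrite ipC ipBr ipC [ip f h]ipC. Qed.

Lemma ipDr f g h : ip f (g \+ h) = ip f g + ip f h.
Proof. by rewrite /ip -big_split; apply: eq_bigr => y _ /=; rewrite mulrDr. Qed.

Lemma ipDl f g h : ip (g \+ h) f = ip g f + ip h f.
Proof. by rewrite ipC ipDr ipC [ip f h]ipC. Qed.

Lemma ipZr c f g : ip f (fun y => c * g y) = c * ip f g.
Proof. by rewrite /ip mulr_sumr; apply: eq_bigr => y _; rewrite mulrCA. Qed.

Lemma ipZl c f g : ip (fun y => c * f y) g = c * ip f g.
Proof. by rewrite ipC ipZr ipC. Qed.

Lemma nrmZ c f : nrm (fun y => c * f y) = `|c| * nrm f.
Proof.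
by rewrite /nrm ipZr ipZl mulrA -expr2 sqrtrM ?sqr_ge0// sqrtr_sqr.
Qed.

Lemma nrm0 : nrm (fun=> 0) = 0.
Proof. by rewrite /nrm /ip big1 ?sqrtr0// => y _; rewrite mulr0. Qed.

Lemma nrm0_eq0 f : nrm f = 0 -> f =1 fun=> 0.
Proof.
move=> f0; have : ip f f = 0 by rewrite -sqr_nrm f0 expr0n.
move/eqP; rewrite psumr_eq0; last by move=> y _; rewrite -expr2 sqr_ge0.
by move=> /allP ff y; have := ff y (mem_index_enum _); rewrite -expr2 sqrf_eq0 => /eqP.
Qed.

Lemma ip_le f g : ip f g <= nrm f * nrm g.
Proof.
have [f0|f0] := eqVneq (nrm f) 0.
  rewrite f0 mul0r /ip big1// => y _; by rewrite (nrm0_eq0 f0) mul0r.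
have [g0|g0] := eqVneq (nrm g) 0.
  rewrite g0 mulr0 /ip big1// => y _; by rewrite (nrm0_eq0 g0) mulr0.
have := ip_ge0 ((fun y => nrm g * f y) \- (fun y => nrm f * g y)).
rewrite !(ipBr, ipBl, ipZl, ipZr) [ip g f]ipC -!sqr_nrm.
have : 0 < nrm f by rewrite lt_def f0 nrm_ge0.
have : 0 < nrm g by rewrite lt_def g0 nrm_ge0.
set a := nrm f; set c := nrm g => cp ap H.
have ac : 0 < a * c by rewrite mulr_gt0.
suff : a * c * ip f g <= a * c * (a * c) by rewrite ler_pM2l.
suff : 0 <= 2 * (a * c * (a * c) - a * c * ip f g) by lra.
by apply: le_trans H _; rewrite le_eqVlt; apply/orP; left; apply/eqP; ring.
Qed.

Lemma nrmN f : nrm (fun y => - f y) = nrm f.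
Proof.
transitivity (nrm (fun y => (-1) * f y)); first by apply: eq_nrm => y; rewrite mulN1r.
by rewrite nrmZ normrN normr1 mul1r.
Qed.

Lemma ip_abs_le f g : `|ip f g| <= nrm f * nrm g.
Proof.
rewrite ler_norml ip_le andbT lerNl -[X in X * _]nrmN.
apply: le_trans (ip_le _ _); rewrite /ip -sumrN le_eqVlt; apply/orP; left.
by apply/eqP/eq_bigr => y _; rewrite mulNr.
Qed.

Lemma nrmD f g : nrm (f \+ g) <= nrm f + nrm g.
Proof.
rewrite -(@ler_pXn2r _ 2)// ?nnegrE ?addr_ge0 ?nrm_ge0//.
rewrite sqr_nrm !(ipDl, ipDr) [ip g f]ipC sqrrD !sqr_nrm.
have := ip_le f g; lra.
Qed.

Lemma nrmB f g : nrm (f \- g) <= nrm f + nrm g.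
Proof. by rewrite -[nrm g]nrmN; exact: nrmD. Qed.

Lemma nrm_dist f g : nrm (f \- g) = nrm (g \- f).
Proof. by rewrite -nrmN; apply: eq_nrm => y /=; rewrite opprB. Qed.

Lemma nrm_sum (I : finType) (F : I -> G -> R) :
  nrm (fun y => \sum_i F i y) <= \sum_i nrm (F i).
Proof.
have H (s : seq I) : nrm (fun y => \sum_(i <- s) F i y) <= \sum_(i <- s) nrm (F i).
  elim: s => [|i s IH].
    by rewrite big_nil (eq_nrm (f' := fun=> 0)) ?nrm0// => y; rewrite big_nil.
  rewrite big_cons (eq_nrm (f' := F i \+ (fun y => \sum_(i <- s) F i y))).
    by apply: le_trans (nrmD _ _) _; rewrite lerD2l.
  by move=> y /=; rewrite big_cons.
exact: H.
Qed.

Definition tr v f : G -> R := fun y => f (y + v).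

Lemma ip_tr v f g : ip (tr v f) (tr v g) = ip f g.
Proof.
by rewrite [RHS](reindex_inj (addIr v)).
Qed.

Lemma ip_trl v f g : ip (tr v f) g = ip f (tr (- v) g).
Proof. by rewrite -(ip_tr v f); apply: eq_ip => // y; rewrite /tr addrK. Qed.

Lemma nrm_tr v f : nrm (tr v f) = nrm f.
Proof. by rewrite /nrm ip_tr. Qed.

Definition av (I : finType) (v : I -> G) f : G -> R :=
  fun y => #|I|%:R^-1 * \sum_i f (y + v i).

Lemma nrm_avg (I : finType) (F : I -> G -> R) c : (0 < #|I|)%N ->
  (forall i, nrm (F i) <= c) -> nrm (fun y => #|I|%:R^-1 * \sum_i F i y) <= c.
Proof.
move=> I0 Fc; rewrite nrmZ ger0_norm ?invr_ge0 ?ler0n//.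
rewrite mulrC ler_pdivrMr ?ltr0n//.
apply: le_trans (nrm_sum _) _.
apply: le_trans (ler_sum _ (fun i _ => Fc i)) _.
by rewrite sumr_const mulr_natr lexx.
Qed.

Lemma nrm_av (I : finType) (v : I -> G) f : (0 < #|I|)%N -> nrm (av v f) <= nrm f.
Proof.
by move=> I0; apply: (nrm_avg (F := fun i => tr (v i) f)) => // i; rewrite nrm_tr.
Qed.

Lemma avB (I : finType) (v : I -> G) f g : av v (f \- g) = av v f \- av v g.
Proof. by apply/funext => y; rewrite /av /= -mulrBr -sumrB. Qed.

Lemma av_tr (I : finType) (v : I -> G) w f : av v (tr w f) = tr w (av v f).
Proof.
by apply/funext => y; rewrite /av /tr; congr (_ * _); apply: eq_bigr => i _; rewrite addrAC.
Qed.

Lemma av_comm (I J : finType) (v : I -> G) (w : J -> G) f :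
  av v (av w f) = av w (av v f).
Proof.
apply/funext => y; rewrite /av -!mulr_sumr mulrCA exchange_big /=; congr (_ * (_ * _)).
by apply: eq_bigr => j _; apply: eq_bigr => i _; rewrite addrAC.
Qed.

Lemma ip_avl (I : finType) (v : I -> G) f g :
  ip (av v f) g = ip f (av (fun i => - v i) g).
Proof.
rewrite /av ipZl ipZr ip_suml ip_sumr; congr (_ * _).
by apply: eq_bigr => i _; apply: ip_trl.
Qed.

(** As a function of [w] it is even and subadditive, so bounds for elementary translations add up
    along a path. *)
Definition osc f w := nrm (tr w f \- f).

Lemma osc_le f w : osc f w <= 2 * nrm f.
Proof. by apply: le_trans (nrmB _ _) _; rewrite nrm_tr; lra. Qed.

Lemma osc0 f : osc f 0 = 0.
Proof.
rewrite /osc -nrm0; apply: eq_nrm.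
by move=> y /=; rewrite /tr addr0 subrr.
Qed.

Lemma oscN f w : osc f (- w) = osc f w.
Proof.
rewrite /osc nrm_dist -(nrm_tr w (f \- _)); apply: eq_nrm => y /=.
by rewrite /tr /= addrK.
Qed.

Lemma oscD f v w : osc f (v + w) <= osc f v + osc f w.
Proof.
rewrite [osc f v](_ : _ = nrm (tr w (tr v f \- f))); last by rewrite nrm_tr.
apply: le_trans (nrmD _ _); rewrite le_eqVlt; apply/orP; left; apply/eqP.
by apply: eq_nrm => y /=; rewrite /tr /= (addrC v w) addrA; ring.
Qed.

Lemma osc_av (I : finType) (v : I -> G) f w : (0 < #|I|)%N ->
  osc (av v f) w <= osc f w.
Proof.
move=> I0; by rewrite /osc -av_tr -avB nrm_av.
Qed.

Lemma av_close (I : finType) (v : I -> G) f c : (0 < #|I|)%N ->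
  (forall i, osc f (v i) <= c) -> nrm (av v f \- f) <= c.
Proof.
move=> I0 vc.
rewrite -(@eq_nrm (fun y => #|I|%:R^-1 * \sum_i (f (y + v i) - f y))).
  exact: (nrm_avg (F := fun i => tr (v i) f \- f)).
move=> y /=; rewrite sumrB mulrBr sumr_const -[f y *+ _]mulr_natl mulrA mulVf ?mul1r//.
by rewrite pnatr_eq0 -lt0n.
Qed.

(** The difference collapses to two sums of [k] terms, so the bound does not grow with [n]. *)
Lemma nrm_telescope (a : nat -> G -> R) (n k : nat) c :
  (forall i, nrm (a i) <= c) ->
  nrm (fun y => \sum_(i < n) (a (i + k)%N y - a i y)) <= (2 * k)%:R * c.
Proof.
move=> ac.
rewrite (@eq_nrm _ ((fun y => \sum_(i < k) a (i + n)%N y) \- (fun y => \sum_(i < k) a i y))).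
  apply: le_trans (nrmB _ _) _; rewrite mul2n -addnn natrD mulrDl; apply: lerD.
    apply: le_trans (nrm_sum (fun i : 'I_k => a (i + n)%N)) _.
    apply: le_trans (ler_sum _ (fun i _ => ac _)) _.
    by rewrite sumr_const card_ord mulr_natl.
  apply: le_trans (nrm_sum (fun i : 'I_k => a i)) _.
  apply: le_trans (ler_sum _ (fun i _ => ac _)) _.
  by rewrite sumr_const card_ord mulr_natl.
move=> y /=; rewrite sumrB.
have shift (u v : nat) : \sum_(i < v) a (i + u)%N y = \sum_(u <= i < u + v) a i y.
  by rewrite -[X in \sum_(X <= _ < _) _]add0n big_addn addKn big_mkord.
have start (u : nat) : \sum_(i < u) a i y = \sum_(0 <= i < u) a i y by rewrite big_mkord.
rewrite !shift !start.
have E1 := @big_cat_nat _ 0 _ n 0 (n + k) xpredT (fun i => a i y) (leq0n _) (leq_addr _ _).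
have E2 := @big_cat_nat _ 0 _ k 0 (k + n) xpredT (fun i => a i y) (leq0n _) (leq_addr _ _).
rewrite (addnC k n) in E2 *.
apply/eqP; rewrite subr_eq addrAC eq_sym subr_eq /=.
by rewrite addrC [X in _ == X]addrC -E1 -E2.
Qed.

Lemma osc_interval (n k : nat) e f :
  (0 < n)%N -> osc (av (fun i : 'I_n => e *+ i) f) (e *+ k) <= (2 * k)%:R / n%:R * nrm f.
Proof.
move=> n0.
have T := @nrm_telescope (fun i => tr (e *+ i) f) n k (nrm f).
rewrite /osc -(@eq_nrm (fun y => n%:R^-1 * \sum_(i < n) (tr (e *+ (i + k)) f y - tr (e *+ i) f y))).
  rewrite nrmZ ger0_norm ?invr_ge0// mulrAC [leRHS]mulrC ler_wpM2l ?invr_ge0//.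
  by apply: T => i; rewrite nrm_tr.
move=> y /=; rewrite /av card_ord -mulrBr sumrB; congr (_ * (_ - _)).
by apply: eq_bigr => i _; rewrite /tr -addrA -mulrnDr addnC.
Qed.

Lemma nrm_avB (I : finType) (v : I -> G) f g : (0 < #|I|)%N ->
  nrm (av v f \- av v g) <= nrm (f \- g).
Proof. by move=> I0; rewrite -avB nrm_av. Qed.

Lemma nrm_triangle h f g : nrm (f \- g) <= nrm (f \- h) + nrm (h \- g).
Proof.
apply: le_trans (nrmD _ _); rewrite le_eqVlt; apply/orP; left; apply/eqP.
by apply: eq_nrm => y /=; ring.
Qed.

Definition selfadj (I : finType) (v : I -> G) :=
  forall f g, ip (av v f) g = ip f (av v g).

(** For a self-adjoint average T the square of the left side expands to |h|^2 - 2 |T h|^2 + |T T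
    h|^2, and T does not increase norms. *)
Lemma nrm_sub_sqr (I : finType) (v : I -> G) h : (0 < #|I|)%N -> selfadj v ->
  nrm (h \- av v (av v h)) <= Num.sqrt (nrm h ^+ 2 - nrm (av v h) ^+ 2).
Proof.
move=> I0 vv; rewrite /nrm ler_wsqrtr// -/(nrm _) !sqr_nrm !(ipBl, ipBr).
rewrite [ip (av v (av v h)) h]ipC -(vv h).
have : nrm (av v (av v h)) ^+ 2 <= nrm (av v h) ^+ 2.
  by rewrite ler_pXn2r ?nnegrE ?nrm_ge0 ?nrm_av.
by rewrite !sqr_nrm; lra.
Qed.

(* The operator [av vB] kills the oscillations that [av vA] averages out and is
   absorbed by [av vC], so it can only differ from the square of [av vC] through the
   energy lost between [av vA] and [av vC]. *)
Lemma energy_comparison (I J K : finType) (vA : I -> G) (vB : J -> G) (vC : K -> G)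
    f b (e : R) : (0 < #|I|)%N -> (0 < #|J|)%N -> (0 < #|K|)%N ->
  selfadj vA -> selfadj vC ->
  (forall i, osc (av vB f) (vA i) <= e) ->
  (forall j, osc (av vC f) (vB j) <= e) ->
  (forall i, osc (av vC f) (vA i) <= e) ->
  ip (av vC b) (av vC f) - nrm b * (5 * e +
    Num.sqrt (nrm (av vA f) ^+ 2 - nrm (av vC f) ^+ 2 + 2 * e * nrm f))
  <= ip b (av vB f).
Proof.
move=> I0 J0 K0 sA sC HA HB HC.
pose A := av vA; pose B := av vB; pose C := av vC.
have AB h : A (B h) = B (A h) by exact: av_comm.
have AC h : A (C h) = C (A h) by exact: av_comm.
have BC h : B (C h) = C (B h) by exact: av_comm.
have e0 : 0 <= e.
  by move/card_gt0P: I0 => [i _]; apply: le_trans (nrm_ge0 _) (HA i).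
have d1 : nrm (B f \- A (B f)) <= e by rewrite nrm_dist; exact: av_close.
have d2 : nrm (A (B f) \- A (A (B f))) <= e by apply: le_trans (nrm_avB _ _ _ I0) d1.
have c1 : nrm (A (C f) \- C f) <= e by exact: av_close.
have c2 : nrm (A (C (C f)) \- C (C f)) <= e.
  by rewrite AC; apply: le_trans (nrm_avB _ _ _ K0) c1.
have c3 : nrm (A (A (C (C f))) \- A (C (C f))) <= e.
  by apply: le_trans (nrm_avB _ _ _ I0) c2.
have c4 : nrm (B (A (A (C (C f)))) \- B (C (C f))) <= 2 * e.
  apply: le_trans (nrm_avB _ _ _ J0) _.
  by have := nrm_triangle (A (C (C f))) (A (A (C (C f)))) (C (C f)); lra.
have c5 : nrm (B (C (C f)) \- C (C f)) <= e.
  rewrite BC; apply: le_trans (nrm_avB _ _ _ K0) _.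
  exact: av_close.
set S := Num.sqrt _.
(* By commutation this is [B (A _)] applied to [A f - C (C (A f))]; [B] and [A] are contractions,
   and [nrm_sub_sqr] applies to [A f]. *)
have d3 : nrm (A (A (B f)) \- B (A (A (C (C f))))) <= S.
  rewrite !AB; apply: le_trans (nrm_avB _ _ _ J0) _.
  apply: le_trans (nrm_avB _ _ _ I0) _.
  rewrite AC; rewrite AC.
  apply: le_trans (nrm_sub_sqr _ K0 sC) _.
  rewrite /S ler_wsqrtr// -/(A f) -/(C f) -/(C (A f)).
  (* The energy obtained is that of [C (A f)]; it is traded for that of [C f] at the price of the
     term [2 * e * nrm f]. *)
  have h1 : nrm (C f) <= nrm (C (A f)) + e.
    rewrite -AC; have := nrm_triangle (A (C f)) (C f) (fun=> 0).
    rewrite !(@eq_nrm (_ \- (fun=> 0)) _ (fun y => subr0 _)).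
    by rewrite nrm_dist in c1; lra.
  have h2 : nrm (C f) <= nrm f by exact: nrm_av.
  have h3 := nrm_ge0 (C (A f)); have h4 := nrm_ge0 (C f).
  suff : nrm (C f) ^+ 2 <= nrm (C (A f)) ^+ 2 + 2 * e * nrm f by lra.
  have [ce|ce] := leP (nrm (C f)) e; first by nra.
  have : (nrm (C f) - e) ^+ 2 <= nrm (C (A f)) ^+ 2.
    by rewrite ler_pXn2r ?nnegrE//; lra.
  by rewrite sqrrB; have := sqr_ge0 e; nra.
(* The path from [B f] to [C (C f)] runs through [A (B f)], [A (A (B f))], [B (A (A (C (C f))))] and
   [B (C (C f))], at the costs e, e, S, 2 e and e. *)
have D : nrm (B f \- C (C f)) <= 5 * e + S.
  have := nrm_triangle (A (B f)) (B f) (C (C f)).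
  have := nrm_triangle (A (A (B f))) (A (B f)) (C (C f)).
  have := nrm_triangle (B (A (A (C (C f))))) (A (A (B f))) (C (C f)).
  have := nrm_triangle (B (C (C f))) (B (A (A (C (C f))))) (C (C f)).
  by lra.
have : ip b (C (C f) \- B f) <= nrm b * (5 * e + S).
  apply: le_trans (ip_le _ _) _; rewrite ler_wpM2l ?nrm_ge0//.
  by rewrite nrm_dist.
by rewrite ipBr -(sC b); lra.
Qed.

(** Differences of positions, instead of positions, make the family symmetric and its average
    self-adjoint. *)
Definition square_shift (n : nat) (e1 e2 : G) (i : ('I_n * 'I_n) * ('I_n * 'I_n)) : G :=
  (e1 *+ i.1.1 - e1 *+ i.1.2) + (e2 *+ i.2.1 - e2 *+ i.2.2).

Lemma selfadj_square n e1 e2 : selfadj (@square_shift n e1 e2).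
Proof.
move=> f g; rewrite ip_avl; apply: eq_ip => // y; rewrite /av; congr (_ * _).
rewrite (reindex_inj (h := fun i : ('I_n * 'I_n) * ('I_n * 'I_n) =>
  ((i.1.2, i.1.1), (i.2.2, i.2.1)))) /=; last first.
  by move=> [[a b] [c d]] [[a' b'] [c' d']] /= [-> -> -> ->].
by apply: eq_bigr => i _; rewrite /square_shift /= opprD !opprB.
Qed.

(** The factorisation into one-dimensional averages reduces [osc_square] to [osc_interval]. *)
Lemma square_av n e1 e2 f : (0 < n)%N ->
  av (@square_shift n e1 e2) f =
  av (fun i : 'I_n => e1 *+ i) (av (fun i : 'I_n => e2 *+ i)
    (av (fun i : 'I_n => - (e1 *+ i)) (av (fun i : 'I_n => - (e2 *+ i)) f))).
Proof.
move=> n0; apply/funext => y; rewrite /av !card_prod !card_ord.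
rewrite -!mulr_sumr.
under [in RHS]eq_bigr do rewrite -mulr_sumr.
rewrite -!mulr_sumr.
under [in RHS]eq_bigr do under eq_bigr do rewrite -mulr_sumr.
under [in RHS]eq_bigr do rewrite -mulr_sumr.
rewrite -!mulr_sumr !mulrA -!invfM -!natrM -!mulnA; congr (_ * _).
have sum_pair (I J : finType) (F : I * J -> R) : \sum_p F p = \sum_i \sum_j F (i, j).
  by rewrite pair_bigA; apply: eq_bigr => -[].
rewrite !sum_pair.
apply: eq_bigr => a _; rewrite exchange_big sum_pair /=.
apply: eq_bigr => c _; rewrite exchange_big /=; apply: eq_bigr => b _.
apply: eq_bigr => d _; rewrite /square_shift /=; congr f.
by rewrite !addrA; congr (_ - _); rewrite -!addrA; congr (_ + (_ + _)); rewrite addrC.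
Qed.

Lemma osc_square n e1 e2 f k l : (0 < n)%N ->
  osc (av (@square_shift n e1 e2) f) (e1 *+ k + e2 *+ l) <=
    (2 * (k + l))%:R / n%:R * nrm f.
Proof.
move=> n0; apply: le_trans (oscD _ _ _) _.
have cn : (0 < #|'I_n|)%N by rewrite card_ord.
rewrite mulnDr natrD !mulrDl square_av//; apply: lerD.
  apply: le_trans (osc_interval _ _ _ n0) _.
  by rewrite ler_wpM2l ?mulr_ge0 ?invr_ge0 ?ler0n//; do 3![apply: le_trans (nrm_av _ _ cn) _].
apply: le_trans (osc_av _ _ _ cn) _.
apply: le_trans (osc_interval _ _ _ n0) _.
by rewrite ler_wpM2l ?mulr_ge0 ?invr_ge0 ?ler0n//; do 2![apply: le_trans (nrm_av _ _ cn) _].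
Qed.

Lemma osc_square_shift n e1 e2 f (c : R) :
  (forall k, (k < n)%N -> osc f (e1 *+ k) <= c) ->
  (forall k, (k < n)%N -> osc f (e2 *+ k) <= c) ->
  forall i, osc f (@square_shift n e1 e2 i) <= 4 * c.
Proof.
move=> H1 H2 [[a b] [k l]]; rewrite /square_shift /=.
apply: le_trans (oscD _ _ _) _.
have := oscD f (e1 *+ a) (- (e1 *+ b)); have := oscD f (e2 *+ k) (- (e2 *+ l)).
rewrite !oscN.
have := H1 a (ltn_ord _); have := H1 b (ltn_ord _).
have := H2 k (ltn_ord _); have := H2 l (ltn_ord _).
by lra.
Qed.

End L2.

(** * Differencing along a circular arc *)

Section VanDerCorput.
Variable R : realType.

Lemma abel_bound (n : nat) (w Psi : nat -> R) (Gam : R) :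
  (forall s, (s <= n.+1)%N -> `|Psi s| <= Gam) ->
  (forall s, (s <= n)%N -> 0 <= w s) ->
  (forall s, (s < n)%N -> w s.+1 <= w s) ->
  `|\sum_(s < n.+1) w s * (Psi s.+1 - Psi s)| <= 2 * Gam * w 0.
Proof.
move=> HP Hw Hm.
(* The boundary term stays inside the absolute value, so that each induction step costs only the
   decrease [w k - w k.+1] of the weights. *)
suff H k : (k <= n)%N -> `|\sum_(s < k.+1) w s * (Psi s.+1 - Psi s) - w k * Psi k.+1|
    <= Gam * (2 * w 0 - w k).
  have h1 := H n (leqnn _); have h2 := HP n.+1 (leqnn _); have h3 := Hw n (leqnn _).
  have : `|w n * Psi n.+1| <= Gam * w n.
    by rewrite normrM ger0_norm// mulrC ler_wpM2r.
  move: h1; rewrite !ler_norml => /andP[a1 a2] /andP[b1 b2]; apply/andP; split; lra.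
elim: k => [|k IH] kn.
  rewrite big_ord_recr big_ord0 /= add0r mulrBr addrAC subrr sub0r normrN normrM ger0_norm ?Hw//.
  by rewrite mulrC (_ : _ * w 0 - _ = w 0) ?ler_wpM2r ?Hw ?HP//; ring.
rewrite big_ord_recr /=; set T := \sum_(_ < _) _.
rewrite [X in `|X|](_ : _ = (T - w k * Psi k.+1) + (w k - w k.+1) * Psi k.+1); last by ring.
have := IH (ltnW kn); rewrite -/T => h; have hp := HP k.+1 (leqW kn).
have : `|(w k - w k.+1) * Psi k.+1| <= Gam * (w k - w k.+1).
  by rewrite normrM ger0_norm ?subr_ge0 ?Hm// mulrC ler_wpM2r// subr_ge0 Hm.
move: h; rewrite !ler_norml => /andP[a1 a2] /andP[b1 b2]; apply/andP; split; lra.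
Qed.

Lemma lipschitz_nat (phi : nat -> R) (om : R) (a b : nat) :
  (forall y, `|phi y.+1 - phi y| <= om) -> `|phi a - phi b| <= om * `|a%:R - b%:R|.
Proof.
move=> H; wlog ab : a b / (b <= a)%N.
  by move=> W; case/orP: (leq_total a b) => ?; last exact: W; rewrite distrC [X in _ * X]distrC; apply: W.
rewrite -(subnKC ab); move: (a - b)%N => k {a ab}.
rewrite natrD addrAC subrr add0r normr_nat.
elim: k => [|k IH]; first by rewrite addn0 subrr normr0 mulr0.
rewrite addnS; apply: le_trans (ler_distD (phi (b + k)%N) _ _) _.
by rewrite -natr1 mulrDr mulr1 addrC; apply: lerD.
Qed.

(** For [x >= 0], the integral from 0 to [x] of the step function with value [phi y] between [y] and
    [y + 1]. *)
Definition interp (phi : nat -> R) (x : R) : R :=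
  \sum_(y < Num.truncn x) phi y + (x - (Num.truncn x)%:R) * phi (Num.truncn x).

Lemma truncnE (x : R) : 0 <= x -> (Num.truncn x)%:R <= x < (Num.truncn x)%:R + 1.
Proof. by move=> x0; rewrite natr1 truncn_itv. Qed.

Lemma interp_bound (phi : nat -> R) (Gam x : R) : 0 <= x ->
  (forall n, `|\sum_(y < n) phi y| <= Gam) -> `|interp phi x| <= Gam.
Proof.
move=> x0 H; rewrite /interp; set k := Num.truncn x.
have /andP[k1 k2] := truncnE x0.
have := H k; have := H k.+1; rewrite big_ord_recr /=.
set P := \sum_(_ < _) _; set p := phi _; rewrite -/k in k1 k2.
rewrite !ler_norml => /andP[a1 a2] /andP[b1 b2].
by apply/andP; split; nra.
Qed.

(** An interval of length at most 1 meets at most two unit cells, whose indices are within 3 of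
    [y]. *)
Lemma interp_diff (phi : nat -> R) (om x x' : R) (y : nat) : 0 <= x -> x <= x' <= x + 1 ->
  `|y%:R - x| <= 1 -> (forall y, `|phi y.+1 - phi y| <= om) ->
  `|interp phi x' - interp phi x - (x' - x) * phi y| <= 3 * om * (x' - x).
Proof.
move=> x0 /andP[xx' x'1] yx H.
have x'0 : 0 <= x' by apply: le_trans xx'.
have /andP[k1 k2] := truncnE x0; have /andP[l1 l2] := truncnE x'0.
have om0 : 0 <= om by apply: le_trans (normr_ge0 _) (H 0%N).
move: yx; rewrite ler_norml => /andP[y1 y2].
rewrite /interp; set k := Num.truncn x in k1 k2 *; set l := Num.truncn x' in l1 l2 *.
have near a (c : R) : `|a%:R - y%:R| <= c -> - (om * c) <= phi a - phi y <= om * c.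
  by move=> ac; rewrite -ler_norml; apply: le_trans (lipschitz_nat a y H) _; rewrite ler_wpM2l.
have kl : (k <= l)%N by rewrite -ltnS -(ltr_nat R) -[l.+1%:R]natr1; lra.
have lk : (l <= k.+1)%N by rewrite -ltnS -(ltr_nat R) -[k.+2%:R]natr1 -[k.+1%:R]natr1; lra.
have /andP[p1 p2] : - (om * 3) <= phi k - phi y <= om * 3.
  by apply: near; rewrite ler_norml; apply/andP; split; lra.
have [E|E] := eqVneq l k.
  rewrite E [X in `|X|](_ : _ = (x' - x) * (phi k - phi y)); last by ring.
  by rewrite ler_norml; apply/andP; split; nra.
have {kl lk E} E : l = k.+1 by apply/eqP; rewrite eqn_leq lk ltn_neqAle eq_sym E kl.
rewrite E in l1 l2 *; rewrite big_ord_recr /=; rewrite -natr1 in l1 l2 *.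
have /andP[q1 q2] : - (om * 3) <= phi k.+1 - phi y <= om * 3.
  by apply: near; rewrite -natr1 ler_norml; apply/andP; split; lra.
rewrite [X in `|X|](_ : _ = (k%:R + 1 - x) * (phi k - phi y) + (x' - (k%:R + 1)) * (phi k.+1 - phi y)); last by ring.
rewrite ler_norml; apply/andP; split; nra.
Qed.

(* Summation by parts against the primitive [interp phi], evaluated along the convex
   sequence [X]: its increments divided by the slopes of [X] approximate [phi (y s)]. *)
Lemma van_der_corput (n : nat) (phi X : nat -> R) (y : nat -> nat) (om Gam mu : R) :
  (forall k, `|phi k.+1 - phi k| <= om) ->
  (forall k, `|\sum_(i < k) phi i| <= Gam) ->
  0 < mu ->
  (forall s, (s <= n)%N -> 0 <= X s) ->
  (forall s, (s < n)%N -> mu <= X s.+1 - X s <= 1) ->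
  (forall s, (s.+1 < n)%N -> X s.+1 - X s <= X s.+2 - X s.+1) ->
  (forall s, (s < n)%N -> `|(y s)%:R - X s| <= 1) ->
  `|\sum_(s < n) phi (y s)| <= 3 * om * n%:R + 2 * Gam / mu.
Proof.
move=> Hom HG mu0 X0 Xi Xc Xy.
have G0 : 0 <= Gam by apply: le_trans (normr_ge0 _) (HG 0%N).
have om0 : 0 <= om by apply: le_trans (normr_ge0 _) (Hom 0%N).
case: n X0 Xi Xc Xy => [|n] X0 Xi Xc Xy.
  by rewrite big_ord0 normr0 mulr0 add0r divr_ge0 ?mulr_ge0// ltW.
pose w s := (X s.+1 - X s)^-1.
pose Psi s := interp phi (X s).
have inc s : (s < n.+1)%N -> 0 < X s.+1 - X s.
  by move=> /Xi /andP[h _]; apply: lt_le_trans h.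
have A := @abel_bound n w Psi Gam.
have {A} A : `|\sum_(s < n.+1) w s * (Psi s.+1 - Psi s)| <= 2 * Gam / mu.
  apply: (@le_trans _ _ (2 * Gam * w 0%N)); first apply: A.
  - by move=> s sn; apply: interp_bound => //; apply: X0.
  - by move=> s sn; rewrite invr_ge0 ltW// inc.
  - move=> s sn; rewrite /w lef_pV2 ?posrE ?inc//; last by rewrite ltnS ltnW.
    by apply: Xc; rewrite ltnS.
  rewrite ler_wpM2l ?mulr_ge0// lef_pV2 ?posrE ?inc//.
  by have /andP[] := Xi 0%N isT.
have B : `|\sum_(s < n.+1) (phi (y s) - w s * (Psi s.+1 - Psi s))| <= 3 * om * n.+1%:R.
  apply: le_trans (ler_norm_sum _ _ _) _.
  apply: (@le_trans _ _ (\sum_(s < n.+1) (3 * om))); last by rewrite sumr_const card_ord mulr_natr.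
  apply: ler_sum => s _; have sp := inc s (ltn_ord s).
  have := @interp_diff phi om (X s) (X s.+1) (y s) (X0 _ (ltnW (ltn_ord s))).
  have /andP[i1 i2] := Xi s (ltn_ord s).
  have -> : X s <= X s.+1 <= X s + 1 by apply/andP; split; lra.
  move=> /(_ isT (Xy _ (ltn_ord s)) Hom).
  rewrite distrC -/(Psi s) -/(Psi s.+1) => h.
  rewrite -(ler_pM2l sp) [leRHS]mulrC; apply: le_trans h.
  rewrite -{1}(gtr0_norm sp) -normrM mulrBr /w mulrA divff ?mul1r ?gt_eqF//.
rewrite sumrB in B.
move: A B; set S := \sum_(_ < _) phi _; set T := \sum_(_ < _) _.
rewrite !ler_norml => /andP[a1 a2] /andP[b1 b2]; apply/andP; split; lra.
Qed.


(** * Geometry of a circular arc *)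

Definition arc (Lam : R) (s : nat) : R := Num.sqrt (Lam ^+ 2 - s%:R ^+ 2).

Section Arc.
Variables (Lam : R) (M : nat).
Hypothesis Lam_gt0 : 0 < Lam.
Hypothesis M_le : (2 * M)%:R <= Lam.

Lemma arc_sqr s : (s <= M)%N -> arc Lam s ^+ 2 = Lam ^+ 2 - s%:R ^+ 2.
Proof.
move=> sM; rewrite sqr_sqrtr// subr_ge0 ler_pXn2r ?nnegrE ?ler0n ?(ltW Lam_gt0)//.
by apply: le_trans M_le; rewrite ler_nat; lia.
Qed.

Lemma arc_ge0 s : 0 <= arc Lam s. Proof. exact: sqrtr_ge0. Qed.

Lemma arc_le s : arc Lam s <= Lam.
Proof.
rewrite -[leRHS](ger0_norm (ltW Lam_gt0)) -sqrtr_sqr ler_wsqrtr//.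
by rewrite lerBlDr lerDl sqr_ge0.
Qed.

Lemma arc_mid s : (s <= M)%N -> s%:R <= Lam / 2 /\ Lam / 2 < arc Lam s.
Proof.
move=> sM; have sL : s%:R <= Lam / 2.
  rewrite ler_pdivlMr// mulrC -natrM; apply: le_trans M_le; rewrite ler_nat; lia.
split=> //; rewrite -(@ltr_pXn2r _ 2) ?nnegrE ?arc_ge0 ?divr_ge0 ?(ltW Lam_gt0)//.
have h : s%:R ^+ 2 <= (Lam / 2) ^+ 2 by rewrite ler_pXn2r ?nnegrE ?divr_ge0 ?(ltW Lam_gt0).
have L2 : 0 < (Lam / 2) ^+ 2 by rewrite exprn_gt0// divr_gt0.
have E : Lam ^+ 2 = 4 * (Lam / 2) ^+ 2 by field.
by rewrite arc_sqr// E; lra.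
Qed.

Lemma arc_step s : (s.+1 <= M)%N -> 0 <= arc Lam s - arc Lam s.+1 <= 1.
Proof.
move=> sM; have := arc_sqr sM; have := arc_sqr (ltnW sM).
have [a1 a2] := arc_mid sM; have [b1 b2] := arc_mid (ltnW sM).
move: a1 a2 b1 b2; rewrite -[s.+1%:R]natr1; have := ler0n R s.
set a := arc _ s; set b := arc _ _; set x := s%:R => x0 a1 a2 b1 b2 ea eb.
have ab : 0 < a + b by lra.
have E : (a - b) * (a + b) = 2 * x + 1 by rewrite -subr_sqr ea eb; ring.
by apply/andP; split; rewrite -(ler_pM2r ab) E ?mul0r ?mul1r; lra.
Qed.

Lemma arc_concave s : (s.+2 <= M)%N -> arc Lam s + arc Lam s.+2 <= 2 * arc Lam s.+1.
Proof.
move=> sM; have := arc_sqr sM; have := arc_sqr (ltnW sM); have := arc_sqr (ltnW (ltnW sM)).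
rewrite -[s.+2%:R]natr1 -[s.+1%:R]natr1.
have := arc_ge0 s; have := arc_ge0 s.+1; have := arc_ge0 s.+2.
set a := arc _ s; set b := arc _ s.+1; set c := arc _ _; set x := s%:R => *.
rewrite -(@ler_pXn2r _ 2) ?nnegrE ?addr_ge0 ?mulr_ge0//.
by have := sqr_ge0 (a - c); nra.
Qed.

(** The vertical distance between two points of the arc at horizontal distance [d]; as a sequence in
    [s] it becomes the [X] of [van_der_corput]. *)
Definition arc_gap d s := arc Lam s - arc Lam (s + d).

Lemma arc_gapE d s : (s + d <= M)%N ->
  arc_gap d s * (arc Lam s + arc Lam (s + d)) = d%:R * (2 * s%:R + d%:R).
Proof.
move=> sM; rewrite -subr_sqr !arc_sqr//; last by lia.
by rewrite natrD; ring.
Qed.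

Lemma arc_gap_ge0 d s : 0 <= arc_gap d s.
Proof.
rewrite subr_ge0 /arc ler_wsqrtr// lerD2l lerN2 ler_pXn2r ?nnegrE ?ler0n//.
by rewrite ler_nat leq_addr.
Qed.

Lemma arc_sum_gt0 d s : (s + d <= M)%N -> 0 < arc Lam s + arc Lam (s + d).
Proof.
by move=> sM; have [_ h] := arc_mid sM; have := arc_ge0 s; have := Lam_gt0; lra.
Qed.

(** By [arc_gapE] the gap times the sum of the two heights is affine in [s] with slope [2 * d]. This
    sum decreases and is at most [2 * Lam], so the gap gains at least [d / Lam] at each step. *)
Lemma arc_gap_slope d s : (s.+1 + d <= M)%N ->
  d%:R / Lam <= arc_gap d s.+1 - arc_gap d s <= 1.
Proof.
move=> sM; have sM' : (s + d <= M)%N by lia.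
have E1 := arc_gapE sM; have E0 := arc_gapE sM'.
have g1 := arc_gap_ge0 d s.+1; have q0 := arc_sum_gt0 sM'.
have /andP[s1 s2] : 0 <= arc Lam s - arc Lam s.+1 <= 1 by apply: arc_step; lia.
have /andP[t1 t2] : 0 <= arc Lam (s + d) - arc Lam (s + d).+1 <= 1 by apply: arc_step.
apply/andP; split; last first.
  by rewrite /arc_gap addSn; lra.
rewrite ler_pdivrMr//.
have l1 := arc_le s; have l2 := arc_le (s + d).
have d0 := ler0n R d.
move: E1 E0 g1; rewrite addSn -[s.+1%:R]natr1.
set g := arc_gap _ s.+1; set g0 := arc_gap _ s.
set Q1 := arc Lam s.+1 + _; set Q0 := arc Lam s + _ => E1 E0 g1.
have h : d%:R * 2 <= (g - g0) * Q0.
  have : g * Q1 <= g * Q0 by rewrite ler_wpM2l// /Q1 /Q0; lra.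
  by rewrite E1 [(g - g0) * _]mulrBl E0; lra.
have gg : 0 <= g - g0 by rewrite -(pmulr_lge0 _ q0) -/Q0; lra.
have : (g - g0) * Q0 <= (g - g0) * (2 * Lam) by rewrite ler_wpM2l// /Q0; lra.
by lra.
Qed.

Lemma arc_gap_convex d s : (s.+2 + d <= M)%N ->
  arc_gap d s.+1 - arc_gap d s <= arc_gap d s.+2 - arc_gap d s.+1.
Proof.
move=> sM; have sM1 : (s.+1 + d <= M)%N by lia.
have sM0 : (s + d <= M)%N by lia.
have := arc_gapE sM; have := arc_gapE sM1; have := arc_gapE sM0.
have := arc_sum_gt0 sM.
have /andP[+ _] := arc_gap_slope sM; have /andP[+ _] := arc_gap_slope sM1.
have d0 : 0 <= d%:R / Lam by rewrite divr_ge0// ltW.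
have /andP[+ _] : 0 <= arc Lam s - arc Lam s.+1 <= 1 by apply: arc_step; lia.
have /andP[+ _] : 0 <= arc Lam s.+1 - arc Lam s.+2 <= 1 by apply: arc_step; lia.
have /andP[+ _] : 0 <= arc Lam (s + d) - arc Lam (s + d).+1 <= 1 by apply: arc_step; lia.
have /andP[+ _] : 0 <= arc Lam (s + d).+1 - arc Lam (s + d).+2 <= 1 by apply: arc_step; lia.
have : arc Lam s + arc Lam s.+2 <= 2 * arc Lam s.+1 by apply: arc_concave; lia.
have : arc Lam (s + d) + arc Lam (s + d).+2 <= 2 * arc Lam (s + d).+1.
  by apply: arc_concave; lia.
rewrite !addSn -[s.+2%:R]natr1 -[s.+1%:R]natr1.
move: (arc Lam s) (arc Lam s.+1) (arc Lam s.+2) (arc Lam (s + d)) (arc Lam (s + d).+1) (arc Lam (s + d).+2).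
move=> a0 a1 a2 b0 b1 b2.
move: (arc_gap d s) (arc_gap d s.+1) (arc_gap d s.+2) => g0 g1 g2.
move=> Cb Ca Sb1 Sb0 Sa1 Sa0 Sg0 Sg1 Q2 E0 E1 E2.
have K0 : 0 <= g1 - g0 by lra.
have K1 : 0 <= g2 - g1 by lra.
rewrite -(ler_pM2r Q2).
(* The sign of [g1] was lost in the generalisation; it is recovered from [E1], which refutes the
   second alternative. *)
have g1p : g1 * (a0 + b0 + (a2 + b2)) <= g1 * (2 * (a1 + b1)) \/ g1 < 0.
  by case: (lerP 0 g1) => h; [left; rewrite ler_wpM2l//; lra|right].
have Q02 : (g1 - g0) * (a2 + b2) <= (g1 - g0) * (a0 + b0) by rewrite ler_wpM2l//; lra.
case: g1p => [h|h]; first by nra.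
have n0 : 0 <= d%:R * (2 * (s%:R + 1) + d%:R) :> R.
  by rewrite !(mulr_ge0, addr_ge0, ler0n, ler01).
have : 0 <= g1 * (a1 + b1) by rewrite E1.
by rewrite pmulr_lge0; lra.
Qed.

Lemma arc_trunc_dist d s :
  `|(Num.truncn (arc Lam s) - Num.truncn (arc Lam (s + d)))%N%:R - arc_gap d s| <= 1.
Proof.
have g0 := arc_gap_ge0 d s.
have h : (Num.truncn (arc Lam (s + d)) <= Num.truncn (arc Lam s))%N.
  by apply: le_truncn; rewrite -subr_ge0.
have /andP[] := truncnE (arc_ge0 s); have /andP[] := truncnE (arc_ge0 (s + d)).
by rewrite natrB// /arc_gap ler_norml => *; apply/andP; split; lra.
Qed.

End Arc.
End VanDerCorput.

(** * Averages over a circular arc *)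

(** Pairs are grouped by their distance [d]. The right side counts distance 0 twice, which is why
    the diagonal is added on the left. *)
Lemma sum_by_gaps (R : realType) (c : nat -> nat -> R) (N : nat) :
  (forall s t, c s t = c t s) ->
  \sum_(s < N) \sum_(t < N) c s t + \sum_(s < N) c s s =
  2 * \sum_(d < N) \sum_(s < N - d) c s (s + d)%N.
Proof.
move=> csym; elim: N => [|N IH]; first by rewrite !big_ord0 mulr0 addr0.
rewrite big_ord_recr /=.
under eq_bigr do rewrite big_ord_recr /=.
rewrite big_split /= big_ord_recr /= [\sum_(s < N.+1) c s s]big_ord_recr /=.
have -> : \sum_(t < N) c N t = \sum_(s < N) c s N by apply: eq_bigr => s _.
have -> : \sum_(d < N.+1) \sum_(s < N.+1 - d) c s (s + d)%N =
  \sum_(d < N) \sum_(s < N - d) c s (s + d)%N + (\sum_(s < N) c s N + c N N).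
  have -> : \sum_(s < N) c s N + c N N = \sum_(d < N.+1) c (N - d)%N N.
    rewrite [RHS](reindex_inj rev_ord_inj) /=.
    transitivity (\sum_(s < N.+1) c s N); first by rewrite big_ord_recr.
    by apply: eq_bigr => s _; congr (c _ _); have := ltn_ord s; lia.
  rewrite [in RHS](_ : \sum_(d < N) \sum_(s < N - d) c s (s + d)%N =
     \sum_(d < N.+1) \sum_(s < N - d) c s (s + d)%N); last first.
    by rewrite [RHS]big_ord_recr /= subnn big_ord0 addr0.
  rewrite -big_split; apply: eq_bigr => d _ /=.
  have dN : (d <= N)%N by rewrite -ltnS ltn_ord.
  by rewrite subSn// big_ord_recr /= subnK.
rewrite mulrDr -IH; ring.
Qed.

Section ArcAverage.
Variables (R : realType) (G : finZmodType) (e1 e2 : G).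
Implicit Types f g : G -> R.

Definition arc_height (Lam : R) (s : nat) : nat := Num.truncn (arc Lam s).

Definition arc_point (Lam : R) (s : nat) : G := e1 *+ s + e2 *+ arc_height Lam s.

(** Each point of the arc is thickened to a vertical run of [J] points. This makes correlations vary
    slowly with the vertical distance, as [van_der_corput] requires. *)
Definition arc_shift (Lam : R) (N J : nat) (i : 'I_N * 'I_J) : G :=
  arc_point Lam i.1 + e2 *+ i.2.

Lemma arc_heightN (Lam : R) s d : (arc_height Lam (s + d) <= arc_height Lam s)%N.
Proof.
apply: le_truncn; rewrite /arc ler_wsqrtr// lerD2l lerN2.
by rewrite ler_pXn2r ?nnegrE// ler_nat leq_addr.
Qed.

Lemma av_arc_shift (Lam : R) (N J : nat) f :
  av (@arc_shift Lam N J) f =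
  av (fun s : 'I_N => arc_point Lam s) (av (fun j : 'I_J => e2 *+ j) f).
Proof.
apply/funext => y; rewrite /av card_prod -mulr_sumr mulrA -invfM -natrM; congr (_ * _).
have sum_pair (I J' : finType) (F : I * J' -> R) : \sum_p F p = \sum_i \sum_j F (i, j).
  by rewrite pair_bigA; apply: eq_bigr => -[].
rewrite sum_pair; apply: eq_bigr => i _; apply: eq_bigr => j _.
by rewrite /arc_shift /= addrA.
Qed.

(* The square of the average is a sum of correlations of pairs of points of the arc.
   For pairs at horizontal distance [d >= d0], the vertical distance has increments at
   least [d / Lam] and van der Corput's lemma applies; the other pairs are few. *)
Lemma osc_arc_vertical (Lam : R) (N J d0 k : nat) f :
  0 < Lam -> (2 * N)%:R <= Lam -> (0 < N)%N -> (0 < J)%N -> (0 < d0)%N ->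
  osc (av (@arc_shift Lam N J) f) (e2 *+ k) ^+ 2 <=
  (8 * d0%:R / N%:R + 48 / J%:R + 16 * k%:R * Lam / (N%:R * d0%:R)) * nrm f ^+ 2.
Proof.
move=> L0 NL N0 J0 d00; set F := nrm f.
have F0 : 0 <= F by exact: nrm_ge0.
have cJ : (0 < #|'I_J|)%N by rewrite card_ord.
pose u := tr (e2 *+ k) f \- f.
have uF : nrm u <= 2 * F by exact: osc_le.
pose g := av (fun j : 'I_J => e2 *+ j) u.
have gF : nrm g <= 2 * F by apply: le_trans (nrm_av _ _ cJ) uF.
have g0 := nrm_ge0 g.
pose z s := arc_point Lam s.
pose c s t := ip (tr (z s) g) (tr (z t) g).
have csym s t : c s t = c t s by exact: ipC.
have cB s t : `|c s t| <= 4 * F ^+ 2.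
  by apply: le_trans (ip_abs_le _ _) _; rewrite !nrm_tr; nra.
have E : osc (av (@arc_shift Lam N J) f) (e2 *+ k) ^+ 2 =
   N%:R^-1 ^+ 2 * \sum_(s < N) \sum_(t < N) c s t.
  rewrite av_arc_shift /osc -av_tr -avB -av_tr -avB -/u -/g sqr_nrm /av card_ord ipZl ipZr mulrA -expr2.
  congr (_ * _); rewrite (ip_suml _ (fun s : 'I_N => tr (z s) g)); apply: eq_bigr => s _.
  by rewrite (ip_sumr _ (fun s : 'I_N => tr (z s) g)).
pose S d := \sum_(s < N - d) c s (s + d)%N.
have Sall d : `|S d| <= N%:R * (4 * F ^+ 2).
  apply: le_trans (ler_norm_sum _ _ _) _.
  apply: (@le_trans _ _ (\sum_(s < N - d) (4 * F ^+ 2))); first exact: ler_sum.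
  rewrite sumr_const card_ord -[X in X <= _]mulr_natl ler_wpM2r ?ler_nat ?leq_subr//.
  by rewrite mulr_ge0// sqr_ge0.
have Sbig d : (d0 <= d < N)%N ->
    `|S d| <= (24 * N%:R / J%:R + 8 * k%:R * Lam / d0%:R) * F ^+ 2.
  move=> /andP[d0d dN].
  pose phi y := ip (tr (e2 *+ y) g) (tr (e1 *+ d) g).
  pose y s := (arc_height Lam s - arc_height Lam (s + d))%N.
  have -> : S d = \sum_(s < N - d) phi (y s).
    apply: eq_bigr => s _.
    rewrite /c /phi -(ip_tr (e1 *+ s + e2 *+ arc_height Lam (s + d)) (tr (e2 *+ y s) g)).
    apply: eq_ip => x; rewrite /tr /z /arc_point; congr g.
      by rewrite -!addrA -mulrnDr subnKC// arc_heightN.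
    by rewrite mulrnDr -!addrA; congr (_ + (_ + _)); rewrite addrC.
  (* The thickening by [J] points enters here: [g] is an average over a vertical interval, so one
     more vertical step changes it by a proportion of order 1 / J. *)
  have om n : `|phi n.+1 - phi n| <= 8 / J%:R * F ^+ 2.
    rewrite /phi -ipBl; apply: le_trans (ip_abs_le _ _) _; rewrite nrm_tr.
    rewrite (@eq_nrm _ _ _ (tr (e2 *+ n) (tr e2 g \- g))); last first.
      by move=> x /=; rewrite /tr /= mulrSr addrA (addrAC x).
    rewrite nrm_tr; have := @osc_interval R G J 1 e2 u J0; rewrite mulr1n muln1 -/g /osc => h.
    have h1 : 2 / J%:R * nrm u <= 2 / J%:R * (2 * F) by rewrite ler_wpM2l ?divr_ge0.
    have h2 : nrm (tr e2 g \- g) * nrm g <= 2 / J%:R * (2 * F) * (2 * F).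
      by rewrite ler_pM ?nrm_ge0// (le_trans h).
    apply: le_trans h2 _; rewrite le_eqVlt; apply/orP; left; apply/eqP.
    by field; rewrite pnatr_eq0 -lt0n.
  (* [g] is itself a difference under the translation by [e2 *+ k], so its sums along [e2] telescope
     and stay bounded in [n]. *)
  have Gam n : `|\sum_(i < n) phi i| <= 4 * k%:R * F ^+ 2.
    rewrite -(ip_suml (tr (e1 *+ d) g) (fun i : 'I_n => tr (e2 *+ i) g)).
    apply: le_trans (ip_abs_le _ _) _; rewrite nrm_tr.
    have h : nrm (fun x => \sum_(i < n) tr (e2 *+ i) g x) <= 2 * k%:R * F.
      pose Ef := av (fun j : 'I_J => e2 *+ j) f.
      rewrite (@eq_nrm _ _ _ (fun x => \sum_(i < n) (tr (e2 *+ (i + k)) Ef x - tr (e2 *+ i) Ef x))).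
        rewrite -natrM; apply: (nrm_telescope (a := fun i => tr (e2 *+ i) Ef)) => i.
        by rewrite nrm_tr nrm_av.
      move=> x; apply: eq_bigr => i _; rewrite /tr /g /u avB av_tr /= /tr -/Ef.
      by rewrite mulrnDr addrA.
    have -> : 4 * k%:R * F ^+ 2 = 2 * k%:R * F * (2 * F) by ring.
    by apply: ler_pM => //; exact: nrm_ge0.
  have d1 : (0 < d)%N by lia.
  have NL' : (2 * N)%:R <= Lam by [].
  have := @van_der_corput R (N - d) phi (arc_gap Lam d) y (8 / J%:R * F ^+ 2)
     (4 * k%:R * F ^+ 2) (d%:R / Lam) om Gam.
  move=> /(_ _ _ _ _ _)/le_trans; apply.
  - by rewrite divr_gt0// ltr0n.
  - by move=> s _; exact: arc_gap_ge0.
  - by move=> s sn; apply: (arc_gap_slope L0 NL'); lia.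
  - by move=> s sn; apply: (arc_gap_convex L0 NL'); lia.
  - by move=> s _; exact: arc_trunc_dist.
  rewrite [leRHS]mulrDl; apply: lerD.
    have -> : 24 * N%:R / J%:R * F ^+ 2 = 3 * (8 / J%:R * F ^+ 2) * N%:R.
      by field; rewrite pnatr_eq0 -lt0n.
    rewrite ler_wpM2l ?ler_nat ?leq_subr//.
    by rewrite !mulr_ge0// ?invr_ge0 ?sqr_ge0.
  have -> : 2 * (4 * k%:R * F ^+ 2) / (d%:R / Lam) = 8 * k%:R * Lam * F ^+ 2 / d%:R.
    by field; rewrite (gt_eqF L0) pnatr_eq0 -lt0n d1.
  rewrite [leRHS]mulrAC ler_wpM2l//; last by rewrite lef_pV2 ?posrE ?ltr0n// ler_nat.
  by rewrite !mulr_ge0// ?sqr_ge0// ltW.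
set A := (24 * N%:R / J%:R + 8 * k%:R * Lam / d0%:R) * F ^+ 2 in Sbig.
have A0 : 0 <= A.
  by rewrite mulr_ge0 ?sqr_ge0// addr_ge0 ?divr_ge0 ?mulr_ge0// ltW.
have ST : \sum_(d < N) S d <= d0%:R * (N%:R * (4 * F ^+ 2)) + N%:R * A.
  apply: (@le_trans _ _ (\sum_(d < N) ((if (d < d0)%N then N%:R * (4 * F ^+ 2) else 0) + A))).
    apply: ler_sum => d _; apply: le_trans (ler_norm _) _.
    case: ltnP => dd; first by apply: le_trans (Sall d) _; rewrite lerDl.
    by rewrite add0r; apply: Sbig; rewrite dd /=.
  rewrite big_split /= sumr_const card_ord -[A *+ N]mulr_natl lerD2r.
  set B := N%:R * _; have B0 : 0 <= B by rewrite !mulr_ge0 ?sqr_ge0.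
  have -> n : \sum_(d < n) (if (d < d0)%N then B else 0) = (minn n d0)%:R * B.
    elim: n => [|n IH]; first by rewrite big_ord0 min0n mul0r.
    rewrite big_ord_recr /= IH; case: (boolP (n < d0)%N) => dd.
      have [-> ->] : minn n d0 = n /\ minn n.+1 d0 = n.+1 by lia.
      by rewrite -natr1 mulrDl mul1r.
    have [-> ->] : minn n d0 = d0 /\ minn n.+1 d0 = d0 by lia.
    by rewrite addr0.
  by rewrite ler_wpM2r// ler_nat geq_minr.
rewrite E.
have NN : 0 < N%:R :> R by rewrite ltr0n.
have diag : 0 <= \sum_(s < N) c s s by apply: sumr_ge0 => s _; exact: ip_ge0.
have T : \sum_(s < N) \sum_(t < N) c s t <= 2 * (d0%:R * (N%:R * (4 * F ^+ 2)) + N%:R * A).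
  have h : \sum_(s < N) \sum_(t < N) c s t + \sum_(s < N) c s s = 2 * \sum_(d < N) S d.
    exact: sum_by_gaps.
  move: h ST diag; set X1 := \sum_(s < N) \sum_(t < N) _; set X2 := \sum_(s < N) _.
  by set X3 := \sum_(d < N) _; set X4 := d0%:R * _ + _ => *; lra.
apply: (@le_trans _ _ (N%:R^-1 ^+ 2 * (2 * (d0%:R * (N%:R * (4 * F ^+ 2)) + N%:R * A)))).
  by rewrite ler_wpM2l ?sqr_ge0.
rewrite le_eqVlt; apply/orP; left; apply/eqP; rewrite /A.
by field; rewrite !pnatr_eq0 -!lt0n N0 J0 d00.
Qed.

Lemma arc_height_step (Lam : R) (N s k : nat) : 0 < Lam -> (2 * N)%:R <= Lam ->
  (s + k <= N)%N -> (arc_height Lam s - arc_height Lam (s + k) <= k.+1)%N.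
Proof.
move=> L0 NL sk.
have gk : arc_gap Lam k s <= k%:R.
  elim: k sk => [|k IH] sk; first by rewrite /arc_gap addn0 subrr.
  have := IH ltac:(lia); rewrite /arc_gap addnS -natr1.
  by have /andP[_] := arc_step L0 NL (s := s + k) ltac:(lia); lra.
have := arc_trunc_dist Lam k s; rewrite ler_norml -/(arc_height Lam s) -/(arc_height Lam (s + k)).
by move=> /andP[_ h]; rewrite -(ler_nat R) -natr1; lra.
Qed.

(* Moving a point of the arc horizontally by [k] leads, up to a vertical move by at most
   [k + 1], to another point of the arc; vertical moves are harmless after smoothing. *)
Lemma osc_arc_horizontal (Lam : R) (N J rho k : nat) f (c : R) :
  0 < Lam -> (2 * (N + k))%:R <= Lam -> (0 < N)%N -> (0 < J)%N -> (0 < rho)%N ->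
  0 <= c ->
  (forall h j, (j < rho)%N -> osc (av (@arc_shift Lam N J) h) (e2 *+ j) <= c * nrm h) ->
  osc (av (@arc_shift Lam N J) f) (e1 *+ k) <=
    (2 * c + (2 * k.+1)%:R / rho%:R + (2 * k)%:R / N%:R) * nrm f.
Proof.
move=> L0 NL N0 J0 r0 c0 Hc; set F := nrm f.
have cJ : (0 < #|'I_J|)%N by rewrite card_ord.
have cr : (0 < #|'I_rho|)%N by rewrite card_ord.
have cN : (0 < #|'I_N|)%N by rewrite card_ord.
have F0 : 0 <= F by exact: nrm_ge0.
pose U := @av R G _ (@arc_shift Lam N J).
pose D := @av R G _ (fun j : 'I_rho => e2 *+ j).
pose h := tr (e1 *+ k) f \- f.
have hF : c * nrm h <= 2 * c * F.
  have -> : 2 * c * F = c * (2 * F) by ring.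
  by rewrite ler_wpM2l//; exact: osc_le.
have -> : osc (U f) (e1 *+ k) = nrm (U h) by rewrite /osc -av_tr -avB.
(* Vertical invariance of [U] permits the insertion of a vertical average over [rho] points. *)
have h1 : nrm (D (U h) \- U h) <= 2 * c * F.
  by apply: le_trans hF; apply: av_close => // j; exact: Hc.
suff h2 : nrm (D (U h)) <= (2 * k.+1)%:R / rho%:R * F + (2 * k)%:R / N%:R * F.
  apply: le_trans (_ : nrm (D (U h)) + nrm (D (U h) \- U h) <= _); last by lra.
  rewrite -[leLHS](@eq_nrm _ _ (D (U h) \- (D (U h) \- U h))); last first.
    by move=> y /=; ring.
  exact: nrmB.
pose f' := D f.
have f'F : nrm f' <= F by exact: nrm_av.
rewrite /D /U av_comm av_arc_shift av_comm; apply: le_trans (nrm_av _ _ cJ) _.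
rewrite -/D /h /D avB av_tr -/D -/f'.
pose z s := arc_point Lam s.
rewrite (@eq_nrm _ _ _ ((fun y => #|'I_N|%:R^-1 * \sum_(s < N) (f' (y + z s + e1 *+ k) - f' (y + z (s + k)%N))) \+
   (fun y => N%:R^-1 * \sum_(s < N) (f' (y + z (s + k)%N) - f' (y + z s))))); last first.
  move=> y /=; rewrite /av card_ord -mulrDr -big_split /=; congr (_ * _).
  by apply: eq_bigr => s _; rewrite /tr; ring.
apply: le_trans (nrmD _ _) _; apply: lerD.
  apply: (nrm_avg (F := fun (s : 'I_N) y => f' (y + z s + e1 *+ k) - f' (y + z (s + k)%N))) => // s.
  pose j := (arc_height Lam s - arc_height Lam (s + k))%N.
  have jk : (j <= k.+1)%N.
    by apply: (arc_height_step (N := N + k)) => //; rewrite leq_add2r ltnW.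
  rewrite (@eq_nrm _ _ _ (tr (z (s + k)%N) (tr (e2 *+ j) f' \- f'))).
    rewrite nrm_tr; apply: le_trans (osc_interval _ _ _ r0) _.
    by rewrite ler_wpM2r// ler_wpM2r ?invr_ge0// ler_nat leq_mul2l.
  move=> y /=; rewrite /tr /=; congr (f' _ - _).
  rewrite /z /arc_point mulrnDr -!addrA; congr (_ + (_ + _)).
  by rewrite addrC; congr (_ + _); rewrite -mulrnDr subnKC// arc_heightN.
rewrite nrmZ ger0_norm ?invr_ge0// mulrAC [leRHS]mulrC ler_wpM2l ?invr_ge0//.
by apply: (nrm_telescope (a := fun s => tr (z s) f')) => i; rewrite nrm_tr.
Qed.

(** For [Lam] at least [4 * P ^ 2] it lies between [Lam / 8] and [Lam / 4]. Being a multiple of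
    [P ^ 2], it makes the threshold [d0 = N / P ^ 2] an integer. *)
Definition arc_size (P : nat) (Lam : R) : nat := (P ^ 2 * Num.truncn (Lam / (4 * P ^ 2)%:R))%N.

Lemma arc_size_bounds P (Lam : R) : (0 < P)%N -> (4 * P ^ 2)%:R <= Lam ->
  [/\ (0 < Num.truncn (Lam / (4 * P ^ 2)%:R))%N, (4 * arc_size P Lam)%:R <= Lam
    & Lam <= (8 * arc_size P Lam)%:R].
Proof.
move=> P0 PL; set t := Num.truncn _.
have PP : 0 < (4 * P ^ 2)%:R :> R by rewrite ltr0n muln_gt0 expn_gt0 P0.
have L1 : 1 <= Lam / (4 * P ^ 2)%:R by rewrite ler_pdivlMr// mul1r.
have t0 : (0 < t)%N by rewrite truncn_gt0.
have /andP[a b] := truncnE (le_trans ler01 L1).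
rewrite -/t in a b; rewrite /arc_size -/t (mulnA 4 (P ^ 2)%N) (mulnA 8 (P ^ 2)%N); split=> //.
  by move: a; rewrite ler_pdivlMr// mulrC -natrM.
have t1 : 1 <= t%:R :> R by rewrite ler1n.
rewrite (_ : 8 * P ^ 2 = 4 * P ^ 2 * 2)%N; last by lia.
rewrite -mulnA natrM -ler_pdivrMl// mulrC natrM; lra.
Qed.

(** With [J = P ^ 2] and [d0 = N / P ^ 2], the three terms of [osc_arc_vertical] are at most 8, 48
    and 1024 over [P ^ 2], in total below [65 ^ 2 / P ^ 2]. The horizontal estimate then gives 2 *
    65 + 2 + 2 = 134. *)
Lemma osc_arc (Lam : R) (P k : nat) f : (1 < P)%N ->
  (4 * P ^ 2)%:R <= Lam -> (k * (2 * P ^ 5))%:R <= Lam ->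
  osc (av (@arc_shift Lam (arc_size P Lam) (P ^ 2)) f) (e1 *+ k) <= 134 / P%:R * nrm f
  /\ osc (av (@arc_shift Lam (arc_size P Lam) (P ^ 2)) f) (e2 *+ k) <= 134 / P%:R * nrm f.
Proof.
move=> P1 PL kL; have P0 : (0 < P)%N by lia.
have PR : 0 < P%:R :> R by rewrite ltr0n.
have [t0 NL LN] := arc_size_bounds P0 PL.
have L0 : 0 < Lam by apply: lt_le_trans PL; rewrite ltr0n; lia.
set N := arc_size P Lam in NL LN *.
have N0 : (0 < N)%N by rewrite muln_gt0 expn_gt0 P0.
have NR : 0 < N%:R :> R by rewrite ltr0n.
have J0 : (0 < P ^ 2)%N by rewrite expn_gt0 P0.
have V (h : G -> R) j : (j * P ^ 4)%:R <= Lam ->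
    osc (av (@arc_shift Lam N (P ^ 2)) h) (e2 *+ j) <= 65 / P%:R * nrm h.
  move=> jL; set t := Num.truncn _ in t0.
  have NE : N = (P ^ 2 * t)%N by [].
  have tR : 0 < t%:R :> R by rewrite ltr0n.
  have NL2 : (2 * N)%:R <= Lam by apply: le_trans NL; rewrite ler_nat; lia.
  have := @osc_arc_vertical Lam N (P ^ 2) t j h L0 NL2 N0 J0 t0.
  move=> H; rewrite -(@ler_pXn2r _ 2) ?nnegrE ?nrm_ge0//; last first.
    by rewrite mulr_ge0 ?nrm_ge0// divr_ge0// ltW.
  apply: le_trans H _; rewrite exprMn ler_wpM2r ?sqr_ge0//.
  (* From [t = N / P ^ 2], [j <= 8 * N / P ^ 4] and [Lam <= 8 * N]. *)
  have e : 16 * j%:R * Lam / (N%:R * t%:R) <= 1024 / P%:R ^+ 2.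
    rewrite ler_pdivrMr ?mulr_gt0// [leRHS]mulrAC ler_pdivlMr ?exprn_gt0//.
    have E : 1024 * (N%:R * t%:R) * P%:R ^+ 2 = 16 * (8 * N)%:R * (8 * N)%:R :> R.
      by rewrite NE !natrM ?natrX; ring.
    have h1 : j%:R * P%:R ^+ 4 <= (8 * N)%:R :> R by rewrite -natrX -natrM; apply: le_trans LN.
    have PP2 : 0 < P%:R ^+ 2 :> R by rewrite exprn_gt0.
    rewrite -(ler_pM2r PP2) E.
    have -> : 16 * j%:R * Lam * P%:R ^+ 2 * P%:R ^+ 2 = 16 * (j%:R * P%:R ^+ 4) * Lam by ring.
    by apply: ler_pM; rewrite ?mulr_ge0 ?ler_wpM2l// ?ltW.
  have e2' : 8 * t%:R / N%:R = 8 / P%:R ^+ 2 :> R.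
    by rewrite NE natrM natrX; field; rewrite !gt_eqF.
  rewrite e2' natrX.
  have -> : (65 / P%:R) ^+ 2 = 4225 / P%:R ^+ 2 :> R by field; rewrite gt_eqF.
  have pp : 0 < P%:R ^- 2 :> R by rewrite invr_gt0 exprn_gt0.
  by lra.
have PR5 : (k * P ^ 4 <= k * (2 * P ^ 5))%N.
  by rewrite leq_mul2l; apply/orP; right; rewrite expnS; have := expn_gt0 P 4; nia.
split; last first.
  apply: le_trans (V f k _) _; first by apply: le_trans kL; rewrite ler_nat.
  by rewrite ler_wpM2r ?nrm_ge0// ler_wpM2r ?invr_ge0// ler_nat.
case: (posnP k) => [->|k0].
  by rewrite mulr0n osc0 mulr_ge0 ?nrm_ge0// divr_ge0.
(* This size makes [k.+1 / rho] of order 1 / P. Vertical invariance up to [rho] asks for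
   [rho * P ^ 4 <= Lam], hence the factor [2 * P ^ 5] in the hypothesis. *)
pose rho := (2 * k * P)%N.
have rho0 : (0 < rho)%N by rewrite !muln_gt0 k0.
have kN : (k * P <= N)%N.
  rewrite -(ler_nat R).
  have : (k * (2 * P ^ 5))%:R <= (8 * N)%:R :> R by apply: le_trans LN.
  rewrite !ler_nat => h.
  have : (8 * (k * P) <= k * (2 * P ^ 5))%N.
    have : (4 <= P ^ 4)%N by apply: (@leq_trans (2 ^ 4)%N) => //; rewrite leq_exp2r.
    by rewrite (_ : (P ^ 5)%N = (P * P ^ 4)%N) ?expnS//; nia.
  by lia.
have := @osc_arc_horizontal Lam N (P ^ 2) rho k f (65 / P%:R) L0.
have h1 : (2 * (N + k))%:R <= Lam.
  by apply: le_trans NL; rewrite ler_nat; nia.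
have h2 : 0 <= 65 / P%:R :> R by rewrite divr_ge0.
have h3 (h : G -> R) j : (j < rho)%N -> osc (av (@arc_shift Lam N (P ^ 2)) h) (e2 *+ j) <= 65 / P%:R * nrm h.
  move=> jr; apply: V; apply: le_trans kL; rewrite ler_nat.
  apply: (@leq_trans (rho * P ^ 4)); first by rewrite leq_mul2r ltnW ?orbT.
  by rewrite /rho [(P ^ 5)%N]expnS; lia.
move=> /(_ h1 N0 J0 rho0 h2 h3)/le_trans; apply.
rewrite ler_wpM2r ?nrm_ge0//.
have r1 : (2 * k.+1)%:R / rho%:R <= 2 / P%:R :> R.
  rewrite ler_pdivrMr ?ltr0n// mulrAC ler_pdivlMr// -!natrM ler_nat /rho; nia.
have r2 : (2 * k)%:R / N%:R <= 2 / P%:R :> R.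
  rewrite ler_pdivrMr// mulrAC ler_pdivlMr// -!natrM ler_nat; lia.
by lra.
Qed.

End ArcAverage.

(** * Popular steps *)

Section Popular.
Variable (G : finZmodType).
Implicit Types (A : {set G}) (u : G).

(** Among [M] consecutive points of a progression with step [u] at most one is isolated: a later one
    would be reached from an earlier one. Averaging over the starting point gives the bound. *)
Lemma card_isolated u A M :
  (M * #|[set p : G | (p \in A) && [forall j : 'I_M, (p + u *+ j.+1)%R \notin A]]| <= #|G|)%N.
Proof.
set B := [set p : G | _].
have -> : (M * #|B| = \sum_(p : G) \sum_(j < M) ((p + u *+ j)%R \in B))%N.
  rewrite exchange_big /= (eq_bigr (fun=> #|B|)) ?sum_nat_const ?card_ord// => j _.
  rewrite -sum1_card [RHS]big_mkcond [RHS](reindex_inj (addIr (u *+ j))) /=.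
  by apply: eq_bigr => p _; case: (_ \in _).
apply: (@leq_trans (\sum_(p : G) 1)%N); last by rewrite sum1_card cardT.
apply: leq_sum => p _.
case: (pickP (fun j : 'I_M => p + u *+ j \in B)) => [j0 j0B|none]; last first.
  by rewrite big1// => j _; rewrite none.
have uniqB (i j : 'I_M) : p + u *+ i \in B -> p + u *+ j \in B -> (i < j)%N -> False.
  rewrite !inE => /andP[_ /forallP iB] /andP[jA _] ij.
  have ji : (j - i.+1 < M)%N by have := ltn_ord j; lia.
  have := iB (Ordinal ji); rewrite /= -addrA -mulrnDr.
  by rewrite (_ : i + (j - i.+1).+1 = j)%N ?jA//; lia.
rewrite (bigD1 j0)//= j0B big1// => j jj0.
case: (boolP (_ \in B)) => // jB; exfalso.
case: (ltngtP j j0) => [h|h|/val_inj/eqP h]; last by rewrite h in jj0.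
  exact: (uniqB j j0).
exact: (uniqB j0 j).
Qed.

Lemma card_bigcup_le (I : finType) (F : I -> {set G}) :
  (#|\bigcup_i F i| <= \sum_i #|F i|)%N.
Proof.
elim/big_ind2 : _ => [|U a V c Ua Vc|//]; first by rewrite cards0.
by apply: leq_trans (leq_card_setU _ _) _; exact: leq_add.
Qed.

(** Points isolated in some direction fill at most half of [A], by the choice of [2 * #|I| * Y].
    Each remaining point has a successful vector of steps, and one vector is the most popular; the
    factor [2 * Y] lost is absorbed by the extra power. *)
Lemma popular_steps (I : finType) (u : I -> G) A (Y : nat) :
  (0 < #|I|)%N -> (#|G| <= Y * #|A|)%N ->
  exists j : {ffun I -> 'I_(2 * #|I| * Y)},
    (#|G| <= (2 * #|I| * Y) ^ #|I|.+1 *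
       #|[set p : G | (p \in A) && [forall i, (p + u i *+ (j i).+1)%R \in A]]|)%N.
Proof.
set M := (2 * #|I| * Y)%N => I0 AY.
pose bad i := [set p : G | (p \in A) && [forall j : 'I_M, p + u i *+ j.+1 \notin A]].
pose B (j : {ffun I -> 'I_M}) := [set p : G | (p \in A) && [forall i, (p + u i *+ (j i).+1)%R \in A]].
have cover : (#|A| <= \sum_(j : {ffun I -> 'I_M}) #|B j| + \sum_i #|bad i|)%N.
  have sub : A \subset (\bigcup_j B j) :|: (\bigcup_i bad i).
    apply/fintype.subsetP => p pA; rewrite inE.
    case: (boolP (p \in \bigcup_i bad i)) => [_|nb]; first by rewrite orbT.
    rewrite orbF.
    have ex i : exists j : 'I_M, p + u i *+ j.+1 \in A.
      apply/existsP; rewrite -[[exists _, _]]negbK negb_exists; apply: contra nb => nb.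
      by apply/finset.bigcupP; exists i => //; rewrite inE pA.
    pose j := [ffun i => xchoose (ex i)].
    apply/finset.bigcupP; exists j => //; rewrite inE pA /=; apply/forallP => i.
    by rewrite ffunE; exact: (xchooseP (ex i)).
  apply: leq_trans (subset_leq_card sub) _; apply: leq_trans (leq_card_setU _ _) _.
  by apply: leq_add; exact: card_bigcup_le.
have M0 : (0 < #|G|)%N by apply/card_gt0P; exists 0.
have badM : (M * \sum_i #|bad i| <= #|I| * #|G|)%N.
  rewrite big_distrr /= -sum_nat_const; apply: leq_sum => i _.
  exact: card_isolated.
have Y0 : (0 < Y)%N by case: (Y) AY M0 => //; rewrite mul0n; case: #|G|.
have bad2 : (2 * \sum_i #|bad i| <= #|A|)%N.
  have IY : (0 < #|I| * Y)%N by rewrite muln_gt0 I0.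
  rewrite -(leq_pmul2l IY) mulnA (_ : #|I| * Y * 2 = M)%N; last by rewrite /M; lia.
  apply: leq_trans badM _; rewrite -mulnA leq_mul2l AY orbT//.
have good : (#|A| <= 2 * \sum_(j : {ffun I -> 'I_M}) #|B j|)%N by lia.
have M1 : (0 < M)%N by rewrite !muln_gt0 I0 Y0.
case: (@arg_maxnP _ [ffun i : I => Ordinal M1] xpredT (fun j => #|B j|) isT) => j _ jmax.
exists j; apply: leq_trans AY _.
have : (\sum_(j : {ffun I -> 'I_M}) #|B j| <= M ^ #|I| * #|B j|)%N.
  apply: (@leq_trans (\sum_(i : {ffun I -> 'I_M}) #|B j|)%N).
    by apply: leq_sum => i _; exact: jmax.
  by rewrite sum_nat_const card_ffun card_ord.
rewrite -/(B j) => h; apply: (@leq_trans (Y * (2 * (M ^ #|I| * #|B j|)))%N).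
  by rewrite leq_mul2l (leq_trans good) ?orbT// leq_mul2l h orbT.
rewrite expnS mulnCA -!mulnA leq_mul2l /=.
by rewrite [leqRHS]mulnA leq_mul2r leq_pmull ?orbT.
Qed.

End Popular.

(** * Corners seen at some scale *)

Section Correlation.
Variables (R : realType) (G : finZmodType) (e1 e2 : G).
Implicit Types f g b : G -> R.

Lemma nrm_le1 f : (forall y, 0 <= f y <= 1) -> nrm f <= Num.sqrt #|G|%:R.
Proof.
move=> f1; rewrite /nrm ler_wsqrtr// /ip -[#|G|]sum1_card natr_sum.
by apply: ler_sum => y _; have /andP[? ?] := f1 y; nra.
Qed.

Lemma sum_av (I : finType) (v : I -> G) f : (0 < #|I|)%N ->
  \sum_y av v f y = \sum_y f y.
Proof.
move=> I0; rewrite /av -mulr_sumr exchange_big /=.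
rewrite (eq_bigr (fun=> \sum_y f y)); last by move=> i _; rewrite [RHS](reindex_inj (addIr (v i))).
rewrite sumr_const -[X in _ * X]mulr_natl mulrA mulVf ?mul1r//.
by rewrite pnatr_eq0 -lt0n.
Qed.

(** Averaging preserves the total of [b]; Cauchy-Schwarz against the constant 1 bounds it by the
    norm of the average, and [f] dominates [b]. *)
Lemma ip_av_mono (I : finType) (v : I -> G) b f : (0 < #|I|)%N ->
  (forall y, 0 <= b y <= f y) ->
  (\sum_y b y) ^+ 2 <= #|G|%:R * ip (av v b) (av v f).
Proof.
move=> I0 bf.
have av0 h y : (forall y, 0 <= h y) -> 0 <= av v h y.
  by move=> h0; rewrite mulr_ge0 ?invr_ge0// sumr_ge0.
apply: (@le_trans _ _ (#|G|%:R * ip (av v b) (av v b))).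
  have := ip_abs_le (av v b) (fun=> 1).
  rewrite {1}/ip (eq_bigr (av v b)); last by move=> y _; rewrite mulr1.
  rewrite sum_av// => h.
  have -> : #|G|%:R * ip (av v b) (av v b) = (nrm (av v b) * nrm (fun _ : G => 1 : R)) ^+ 2.
    rewrite exprMn !sqr_nrm mulrC; congr (_ * _).
    by rewrite /ip (eq_bigr (fun=> 1)) ?sumr_const// => y _; rewrite mulr1.
  by rewrite -[leLHS]real_normK ?num_real// ler_pXn2r ?nnegrE ?mulr_ge0 ?nrm_ge0.
rewrite ler_wpM2l// /ip; apply: ler_sum => y _.
have b0 z : 0 <= b z by have /andP[] := bf z.
rewrite ler_wpM2l ?av0// /av ler_wpM2l ?invr_ge0//.
by apply: ler_sum => i _; have /andP[] := bf (y + v i).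
Qed.

Lemma small_drop (E : nat -> R) (c : R) (S : nat) : (0 < S)%N -> 0 <= E S -> E 0%N <= c ->
  exists2 s, (s < S)%N & E s - E s.+1 <= c / S%:R.
Proof.
move=> S0 ES E0; have SR : 0 < S%:R :> R by rewrite ltr0n.
case: (pickP (fun s : 'I_S => E s - E s.+1 <= c / S%:R)) => [s Hs|none].
  by exists s.
have H k : (k <= S)%N -> E k <= E 0%N - k%:R * (c / S%:R).
  elim: k => [|k IH] kS; first by rewrite mul0r subr0.
  have := IH (ltnW kS); have /negbT := none (Ordinal kS); rewrite -ltNge /= -natr1 => *; lra.
have := H S (leqnn _); rewrite mulrC divfK ?gt_eqF// => h.
(* The induction yields only a weak inequality, compatible with [E S = 0]; the last drop is redone
   strictly. *)
have k0 : (S.-1 < S)%N by lia.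
have /negbT := none (Ordinal k0); rewrite -ltNge /= prednK// => h1.
have := H _ (ltnW k0).
have -> : S.-1%:R = S%:R - 1 :> R by rewrite -subn1 natrB.
rewrite mulrBl mul1r [S%:R * _]mulrC divfK ?gt_eqF//; lra.
Qed.

(** The radius [Lam s] is much larger than [rho s] and much smaller than [rho s.+1], which supplies
    the three invariance hypotheses of [energy_comparison]. The scale is selected from the energies
    of [f] alone, so [b] may vary with it. *)
Lemma arc_correlation (S P : nat) (Lam : nat -> R) (rho : nat -> nat) f (b : nat -> G -> R) (beta : R) :
  (1 < P)%N -> (0 < S)%N -> 0 < beta <= 1 ->
  32 <= beta ^+ 4 * S%:R -> 64 * 536 <= beta ^+ 4 * P%:R ->
  (forall s, (s <= S)%N -> (0 < rho s)%N) ->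
  (forall s, (s < S)%N -> [/\ (4 * P ^ 2)%:R <= Lam s, (rho s * (2 * P ^ 5))%:R <= Lam s
      & Lam s * (2 * P)%:R <= (rho s.+1)%:R]) ->
  (forall y, 0 <= f y <= 1) ->
  (forall s, (s < S)%N -> (forall y, 0 <= b s y <= f y) /\ beta * #|G|%:R <= \sum_y b s y) ->
  exists2 s, (s < S)%N &
    beta ^+ 2 / 2 * #|G|%:R <= ip (b s) (av (@arc_shift R G e1 e2 (Lam s) (arc_size P (Lam s)) (P ^ 2)) f).
Proof.
move=> P1 S0 /andP[b0 b1] HS HP rho0 HL f1 Hb.
have P0 : (0 < P)%N by lia.
have PR : 0 < P%:R :> R by rewrite ltr0n.
pose D s := @av R G _ (@square_shift G (rho s) e1 e2).
have n0 : 0 < #|G|%:R :> R by rewrite ltr0n; apply/card_gt0P; exists 0.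
set n := #|G|%:R in n0 *.
have fn : nrm f <= Num.sqrt n by exact: nrm_le1.
have sn : Num.sqrt n ^+ 2 = n by rewrite sqr_sqrtr// ltW.
have sn0 : 0 <= Num.sqrt n by exact: sqrtr_ge0.
have cD s : (s <= S)%N -> (0 < #|(('I_(rho s) * 'I_(rho s)) * ('I_(rho s) * 'I_(rho s)) : finType)%type|)%N.
  by move=> /rho0 r0; rewrite !card_prod !card_ord !muln_gt0 r0.
have E0 : nrm (D 0%N f) ^+ 2 <= n.
  rewrite -sn ler_pXn2r ?nnegrE ?nrm_ge0//; apply: le_trans fn; apply: nrm_av; exact: cD.
have [s sS drop] := small_drop (E := fun s => nrm (D s f) ^+ 2) S0 (sqr_ge0 _) E0.
exists s => //; have [L1 L2 L3] := HL s sS; have [bf bs] := Hb s sS.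
have [t0 NL LN] := arc_size_bounds P0 L1.
set N := arc_size P (Lam s) in NL LN *.
have NN0 : (0 < N)%N by rewrite muln_gt0 expn_gt0 P0.
have L0 : 0 < Lam s by apply: lt_le_trans L1; rewrite ltr0n muln_gt0 expn_gt0 P0.
have rr0 : 0 < (rho s.+1)%:R :> R by rewrite ltr0n rho0.
have ratio k : k%:R <= 2 * Lam s -> (2 * k)%:R / (rho s.+1)%:R * nrm f <= 134 / P%:R * Num.sqrt n.
  move=> kL; apply: ler_pM => //; rewrite ?divr_ge0 ?nrm_ge0//.
  rewrite ler_pdivrMr// mulrAC ler_pdivlMr// natrM.
  move: L3; rewrite natrM => L3.
  have : k%:R * P%:R <= 2 * Lam s * P%:R by rewrite ler_wpM2r// ltW.
  by lra.
have c0 : 0 <= 536 / P%:R :> R by rewrite mulr_ge0 ?invr_ge0 ?ler0n.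
(* 536 = 4 * 134, since a [square_shift] is composed of four steps. *)
pose eps := 536 / P%:R * Num.sqrt n.
have epsE : eps = 4 * (134 / P%:R * Num.sqrt n) by rewrite /eps; field; rewrite gt_eqF.
have HA i : osc (av (@arc_shift R G e1 e2 (Lam s) N (P ^ 2)) f) (@square_shift G (rho s) e1 e2 i) <= eps.
  rewrite epsE; apply: osc_square_shift => k kr.
    apply: le_trans (proj1 (osc_arc e1 e2 (k := k) f P1 L1 _)) _.
      by apply: le_trans L2; rewrite ler_nat leq_mul2r ltnW ?orbT.
    by rewrite ler_wpM2l// divr_ge0.
  apply: le_trans (proj2 (osc_arc e1 e2 (k := k) f P1 L1 _)) _.
    by apply: le_trans L2; rewrite ler_nat leq_mul2r ltnW ?orbT.
  by rewrite ler_wpM2l// divr_ge0.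
have Hs1 : (0 < rho s.+1)%N by exact: rho0.
have HC : forall j, osc (D s.+1 f) (@arc_shift R G e1 e2 (Lam s) N (P ^ 2) j) <= eps.
  move=> [i j]; rewrite /arc_shift /arc_point /= -addrA -mulrnDr.
  apply: le_trans (osc_square _ _ _ _ _ Hs1) _.
  apply: (@le_trans _ _ (134 / P%:R * Num.sqrt n)); last first.
    by rewrite epsE; have : 0 <= 134 / P%:R * Num.sqrt n; [rewrite mulr_ge0 ?divr_ge0|lra].
  apply: ratio; rewrite !natrD.
  have iN : i%:R <= Lam s / 4.
    rewrite ler_pdivlMr// mulrC -natrM; apply: le_trans NL; rewrite ler_nat leq_mul2l /=.
    exact/ltnW/ltn_ord.
  have hL : (arc_height (Lam s) i)%:R <= Lam s.
    by have /andP[h _] := truncnE (arc_ge0 (Lam s) i); apply: le_trans h (arc_le L0 _).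
  have jP : j%:R <= Lam s / 4.
    rewrite ler_pdivlMr// mulrC -natrM; apply: le_trans L1; rewrite ler_nat leq_mul2l /=.
    exact/ltnW/ltn_ord.
  by lra.
have rL : (rho s)%:R <= 2 * Lam s.
  apply: le_trans (_ : _ <= Lam s) _; last by lra.
  by apply: le_trans L2; rewrite ler_nat leq_pmulr// muln_gt0 expn_gt0 P0.
have HCA i : osc (D s.+1 f) (@square_shift G (rho s) e1 e2 i) <= eps.
  have kL k : (k < rho s)%N -> k%:R <= 2 * Lam s.
    by move=> kr; apply: le_trans rL; rewrite ler_nat ltnW.
  rewrite epsE; apply: osc_square_shift => k kr.
    have := @osc_square R G (rho s.+1) e1 e2 f k 0 Hs1; rewrite mulr0n addr0 addn0.
    by move=> /le_trans; apply; apply: ratio; exact: kL.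
  have := @osc_square R G (rho s.+1) e1 e2 f 0 k Hs1; rewrite mulr0n add0r add0n.
  by move=> /le_trans; apply; apply: ratio; exact: kL.
have cJ : (0 < #|('I_N * 'I_(P ^ 2) : finType)%type|)%N.
  by rewrite card_prod !card_ord muln_gt0 NN0 expn_gt0 P0.
have := energy_comparison (b s) (cD s (ltnW sS)) cJ (cD s.+1 sS)
  (@selfadj_square _ _ _ _ _) (@selfadj_square _ _ _ _ _) HA HC HCA.
apply: le_trans; rewrite -/(D s f) -/(D s.+1 f).
have main : beta ^+ 2 * n <= ip (D s.+1 (b s)) (D s.+1 f).
  have := ip_av_mono (@square_shift G (rho s.+1) e1 e2) (cD _ sS) bf; rewrite -/n => h.
  rewrite -(ler_pM2l n0); apply: le_trans h.
  have -> : n * (beta ^+ 2 * n) = (beta * n) ^+ 2 by ring.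
  by rewrite ler_pXn2r ?nnegrE ?mulr_ge0 ?(ltW b0) ?(ltW n0)// (le_trans _ bs)// mulr_ge0 ?ltW.
have bn : nrm (b s) <= Num.sqrt n.
  apply: nrm_le1 => y; have /andP[-> h] := bf y; have /andP[_ h1] := f1 y.
  exact: le_trans h h1.
have B4 : 0 < beta ^+ 4 by rewrite exprn_gt0.
have B2 : 0 < beta ^+ 2 by rewrite exprn_gt0.
have B42 : beta ^+ 4 <= beta ^+ 2.
  by rewrite -[leRHS]mulr1 -[4%N]/(2 + 2)%N exprD ler_pM2l// exprn_ile1// ltW.
have SR : 0 < S%:R :> R by rewrite ltr0n.
have eP : 536 / P%:R <= beta ^+ 4 / 64.
  by rewrite ler_pdivrMr//; lra.
have eS : S%:R^-1 <= beta ^+ 4 / 32.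
  by rewrite -[S%:R^-1]mul1r ler_pdivrMr//; lra.
(* The energy drop and the term with [eps] contribute [beta ^+ 4 / 32 * n] each, in total the square
   of [beta ^+ 2 / 4] times [n]; this fixes the constants 32 and 64 of the hypotheses. *)
have root : Num.sqrt (nrm (D s f) ^+ 2 - nrm (D s.+1 f) ^+ 2 + 2 * eps * nrm f) <= beta ^+ 2 / 4 * Num.sqrt n.
  have -> : beta ^+ 2 / 4 * Num.sqrt n = Num.sqrt ((beta ^+ 2 / 4) ^+ 2 * n).
    by rewrite sqrtrM ?sqr_ge0// sqrtr_sqr ger0_norm// divr_ge0// ltW.
  rewrite ler_wsqrtr//.
  have h1 : eps * nrm f <= 536 / P%:R * n.
    rewrite /eps -mulrA; apply: (ler_wpM2l c0).
    by rewrite -[leRHS]sn expr2; exact: ler_wpM2l.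
  have h2 : 536 / P%:R * n <= beta ^+ 4 / 64 * n by rewrite ler_wpM2r// ltW.
  have h3 : n / S%:R <= beta ^+ 4 / 32 * n by rewrite mulrC ler_wpM2r// ltW.
  have -> : (beta ^+ 2 / 4) ^+ 2 = beta ^+ 4 / 16 by field.
  by lra.
have e5 : 5 * eps <= beta ^+ 2 / 4 * Num.sqrt n.
  rewrite /eps mulrA ler_wpM2r//; lra.
set T := 5 * eps + _.
have TT : nrm (b s) * T <= beta ^+ 2 / 2 * n.
  apply: (@le_trans _ _ (Num.sqrt n * (beta ^+ 2 / 2 * Num.sqrt n))); last first.
    by rewrite mulrCA -expr2 sn.
  apply: ler_pM => //; rewrite ?nrm_ge0// /T; last by lra.
  exact: addr_ge0 (mulr_ge0 (ler0n _ _) (mulr_ge0 c0 sn0)) (sqrtr_ge0 _).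
by lra.
Qed.

End Correlation.

(** * Corners of prescribed volume in a torus *)

Section Discrete.
Variables (R : realType) (G : finZmodType) (I : finType).
Variables (u : I -> G) (e1 e2 : G).
Implicit Types A : {set G}.

Definition indic A (p : G) : R := (p \in A)%:R.

Lemma indic_ge0_le1 A p : 0 <= indic A p <= 1.
Proof. by rewrite /indic ler0n lern1 leq_b1. Qed.

Lemma sum_indic A : \sum_p indic A p = #|A|%:R.
Proof. by rewrite -sum1_card natr_sum [RHS]big_mkcond; apply: eq_bigr => p _; rewrite /indic; case: (_ \in _). Qed.

(* the length of the last edge, in lattice units, that turns the other edges, of
   lengths [(j i).+1 / b ^ s.+1], into those of a simplex of volume 1; the lattice
   has mesh [1 / D] *)
Definition radius (b D s M : nat) (j : {ffun I -> 'I_M}) : R :=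
  (#|I|.+1`! * b ^ (s.+1 * #|I|) * D)%:R / (\prod_i (j i).+1)%:R.

Definition corner_set A (step M : nat) (j : {ffun I -> 'I_M}) : {set G} :=
  [set p : G | (p \in A) && [forall i, p + u i *+ (step * (j i).+1) \in A]].

Lemma radius_bounds (b D s M : nat) (j : {ffun I -> 'I_M}) :
  (#|I|.+1`! * b ^ (s.+1 * #|I|) * D)%:R <= radius b D s j * (M ^ #|I|)%:R /\
  radius b D s j <= (#|I|.+1`! * b ^ (s.+1 * #|I|) * D)%:R.
Proof.
have p0 : (0 < \prod_i (j i).+1)%N by apply: prodn_gt0.
have pM : (\prod_i (j i).+1 <= M ^ #|I|)%N.
  by rewrite -prod_nat_const; apply: leq_prod => i _; exact: ltn_ord.
rewrite /radius; split.
  rewrite mulrAC ler_pdivlMr ?ltr0n// ler_wpM2l// ler_nat//.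
by rewrite ler_pdivrMr ?ltr0n// ler_peMr// ler1n.
Qed.

(** Popular lengths are chosen at every scale beforehand, which fixes all the radii; only then does
    [arc_correlation] select a scale. *)
Lemma discrete_pattern (Y P S b D : nat) (step : nat -> nat) A :
  let X := (2 * #|I| * Y)%N in
  (0 < #|I|)%N -> (0 < Y)%N -> (1 < P)%N -> (0 < D)%N ->
  (32 * X ^ (4 * #|I|.+1) <= S)%N ->
  64 * 536 * (X ^ (4 * #|I|.+1))%:R <= P%:R :> R ->
  (4 * P ^ 6 * X <= b)%N ->
  (#|G| <= Y * #|A|)%N ->
  exists s (j : {ffun I -> 'I_X}), (s < S)%N /\
    (X ^ (2 * #|I|.+1))%:R^-1 / 2 * #|G|%:R <=
      ip (indic (corner_set A (step s) j))
         (av (@arc_shift R G e1 e2 (radius b D s j) (arc_size P (radius b D s j)) (P ^ 2)) (indic A)).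
Proof.
move=> X I0 Y0 P1 D0 XS XP Xb GA.
set m := #|I|.+1 in XS XP *.
have X0 : (0 < X)%N by rewrite !muln_gt0 I0.
have P0 : (0 < P)%N by lia.
have Xm0 : (0 < X ^ m)%N by rewrite expn_gt0 X0.
have [j jP] : {j : nat -> {ffun I -> 'I_X} & forall s,
    (#|G| <= X ^ m * #|corner_set A (step s) (j s)|)%N}.
  apply: (@choice _ _ (fun s j => #|G| <= X ^ m * #|corner_set A (step s) j|)%N) => s.
  have [j jG] := popular_steps (fun i => u i *+ step s) I0 GA.
  exists j; apply: leq_trans jG _; rewrite leq_mul2l; apply/orP; right.
  apply: subset_leq_card; apply/fintype.subsetP => p; rewrite !inE => /andP[-> /forallP H] /=.
  by apply/forallP => i; rewrite mulrnA; exact: H.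
pose Lam s := radius b D s (j s).
(* With this value the bound of [Lam s] by [rho s.+1] is the upper half of [radius_bounds]. The
   lower half loses a factor [X ^ #|I|], which [4 * P ^ 6 * X <= b] makes up for. *)
pose rho s := (2 * P * (m`! * b ^ (s * #|I|) * D))%N.
pose beta : R := (X ^ m)%:R^-1.
have XmR : 0 < (X ^ m)%:R :> R by rewrite ltr0n.
have b0 : 0 < beta <= 1 by rewrite invr_gt0 XmR invf_le1// ler1n.
have b4 : beta ^+ 4 = (X ^ (4 * m))%:R^-1 by rewrite /beta exprVn -natrX -expnM mulnC.
have X4 : 0 < (X ^ (4 * m))%:R :> R by rewrite ltr0n expn_gt0 X0.
have bpos : (0 < b)%N by apply: leq_trans Xb; rewrite muln_gt0 X0 muln_gt0 expn_gt0 P0.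
have := @arc_correlation R G e1 e2 S P Lam rho (indic A) (fun s => indic (corner_set A (step s) (j s))) beta.
case => //.
- by apply: leq_trans XS; rewrite muln_gt0 expn_gt0 X0.
- rewrite b4 [leRHS]mulrC ler_pdivlMr//; move: XS; rewrite -(ler_nat R) natrM.
  by [].
- by rewrite b4 [leRHS]mulrC ler_pdivlMr.
- by move=> s _; rewrite /rho !muln_gt0 P0 fact_gt0 expn_gt0 bpos.
- move=> s sS; have [h1 h2] := @radius_bounds b D s X (j s); rewrite -/(Lam s) -/m in h1 h2.
  have XIR : 0 < (X ^ #|I|)%:R :> R by rewrite ltr0n expn_gt0 X0.
  have bX : (4 * P ^ 6 * X ^ #|I| <= b ^ #|I|)%N.
    apply: (@leq_trans ((4 * P ^ 6 * X) ^ #|I|)); last by rewrite leq_exp2r.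
    rewrite expnMn leq_mul2r; apply/orP; right.
    rewrite -[X in (X <= _)%N]expn1 leq_pexp2l// muln_gt0 expn_gt0 P0//.
  have main c : (c <= m`! * b ^ (s * #|I|) * D * (4 * P ^ 6))%N -> c%:R <= Lam s.
    move=> hc; rewrite -(ler_pM2r XIR); apply: le_trans h1; rewrite -natrM ler_nat.
    apply: (@leq_trans (m`! * b ^ (s * #|I|) * D * (4 * P ^ 6) * X ^ #|I|)).
      by rewrite leq_mul2r hc orbT.
    rewrite mulSn expnD -[leqLHS]mulnA.
    rewrite (_ : m`! * (b ^ #|I| * b ^ (s * #|I|)) * D = m`! * b ^ (s * #|I|) * D * b ^ #|I|)%N; last by lia.
    by rewrite leq_mul2l bX orbT.
  have pos : (0 < m`! * b ^ (s * #|I|) * D)%N by rewrite !muln_gt0 fact_gt0 expn_gt0 bpos.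
  split.
  + apply: main; rewrite (_ : 6 = 2 + 4)%N// expnD.
    have := leq_mul pos (leqnn (4 * P ^ 2)); have : (0 < P ^ 4)%N by rewrite expn_gt0 P0.
    nia.
  + by apply: main; rewrite /rho (expnS P 5); lia.
  + rewrite /rho -/m [leLHS]mulrC [in leRHS]natrM ler_wpM2l//.
- exact: indic_ge0_le1.
- move=> s sS; split.
    by move=> p; rewrite /indic ler0n ler_nat /corner_set inE; case: (p \in A); case: [forall i, _].
  rewrite sum_indic /beta mulrC ler_pdivrMr// mulrC -natrM ler_nat; exact: jP.
move=> s sS H; exists s, (j s); split=> //.
suff -> : (X ^ (2 * m))%:R^-1 = beta ^+ 2 by [].
by rewrite /beta exprVn -natrX -expnM mulnC.
Qed.

End Discrete.

(** * Lebesgue outer measure on R^n *)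

Local Open Scope classical_set_scope.

Section Outer.
Variables (R : realType) (n : nat).
Local Notation T := 'rV[R]_n.+1.
Implicit Types (a b x v : T) (X : set T).

Lemma box_volume_ge0 a b : (forall i, a 0 i <= b 0 i) -> 0 <= box_volume a b.
Proof. by move=> ab; apply: prodr_ge0 => i _; rewrite subr_ge0. Qed.

(** The reason for working in dimension [n.+1]: in dimension 0 the empty product is 1. Degenerate
    boxes pad finite covers to sequences. *)
Lemma box_volume0 a : box_volume a a = 0.
Proof. by rewrite /box_volume (bigD1 ord0)//= subrr mul0r. Qed.

Definition louter : set T -> \bar R := @lebesgue_outer R n.+1.

Lemma louter_le X (a b : nat -> T) : (forall k i, a k 0 i <= b k 0 i) ->
  X `<=` \bigcup_k box (a k) (b k) ->
  (louter X <= \sum_(0 <= k <oo) (box_volume (a k) (b k))%:E)%E.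
Proof. by move=> ab Xab; apply: ereal_inf_lbound; exists a, b. Qed.

Lemma louter_ge0 X : (0 <= louter X)%E.
Proof.
apply: le_ereal_inf_tmp => _ [a [b [ab _ ->]]].
by apply: nneseries_ge0 => k _ _; rewrite lee_fin box_volume_ge0.
Qed.

Lemma louter_mono : {homo louter : A B / A `<=` B >-> (A <= B)%E}.
Proof.
move=> A B AB; apply/ereal_inf_le_tmp => _ [a [b [ab Bab ->]]].
by exists a, b; split=> //; apply: subset_trans Bab.
Qed.

Lemma louter_box a b : (forall i, a 0 i <= b 0 i) -> (louter (box a b) <= (box_volume a b)%:E)%E.
Proof.
move=> ab.
apply: le_trans (@louter_le _ (fun=> a) (fun k => if k == 0%N then b else a) _ _) _.
- by move=> k i; case: ifP.
- by move=> x xab; exists 0%N.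
rewrite (nneseries_recl _)//; last by move=> k _; rewrite lee_fin; case: ifP => _; [exact: box_volume_ge0|rewrite box_volume0].
rewrite eseries0 ?adde0// => -[//|k] _ _ /=; by rewrite box_volume0.
Qed.

Lemma louter0 : louter set0 = 0%E.
Proof.
apply/eqP; rewrite eq_le louter_ge0 andbT.
apply: le_trans (louter_mono (sub0set (box 0 0))) _.
by apply: le_trans (louter_box _) _ => //; rewrite box_volume0.
Qed.

Lemma louter_cover X (e : R) : 0 < e -> (louter X < +oo)%E ->
  exists a b : nat -> T, [/\ forall k i, a k 0 i <= b k 0 i,
    X `<=` \bigcup_k box (a k) (b k) &
    (\sum_(0 <= k <oo) (box_volume (a k) (b k))%:E <= louter X + e%:E)%E].
Proof.
move=> e0 Xoo.
have fX : louter X \is a fin_num by rewrite ge0_fin_numE ?louter_ge0.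
have [_ [a [b [ab Xab ->]]] h] := lb_ereal_inf_adherent e0 fX.
by exists a, b; split=> //; apply: ltW.
Qed.

Lemma louter_sigma_subadditive : sigma_subadditive louter.
Proof.
move=> A; have [[i ioo]|] := pselect (exists i, louter (A i) = +oo%E).
  rewrite (eseries_pinfty _ _ ioo) ?leey// => k _.
  by rewrite -ltNye (lt_le_trans _ (louter_ge0 _)).
rewrite -forallNE => Aoo.
apply/lee_addgt0Pr => e e0.
rewrite (le_trans _ (epsilon_trick _ _ (ltW e0)))//; last by move=> k; exact: louter_ge0.
have Ae k : (0 < e / (2 ^ k.+1)%:R :> R) by rewrite divr_gt0// ltr0n expn_gt0.
have fA k : (louter (A k) < +oo)%E by rewrite ltey; apply/eqP; exact: Aoo.
pose P k (c : (nat -> T) * (nat -> T)) := [/\ forall j i, c.1 j 0 i <= c.2 j 0 i,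
    A k `<=` \bigcup_j box (c.1 j) (c.2 j) &
    (\sum_(0 <= j <oo) (box_volume (c.1 j) (c.2 j))%:E <= louter (A k) + (e / (2 ^ k.+1)%:R)%:E)%E].
have [c cP] : {c & forall k, P k (c k)}.
  apply: choice => k; have [a [b [ab Aab le]]] := louter_cover (Ae k) (fA k).
  by exists (a, b).
have /card_esym/ppcard_eqP[f] := card_nat2.
apply: le_trans (@louter_le _ (fun k => (c (f k).1).1 (f k).2) (fun k => (c (f k).1).2 (f k).2) _ _) _.
- by move=> k i; have [h _ _] := cP (f k).1; exact: h.
- move=> x [i _ Aix]; have [_ h _] := cP i; have [j _ xj] := h x Aix.
  by exists (f^-1%FUN (i, j)) => //=; rewrite invK ?inE.
pose V (p : nat * nat) : \bar R := (box_volume ((c p.1).1 p.2) ((c p.1).2 p.2))%:E.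
have V0 p : (0 <= V p)%E by rewrite lee_fin box_volume_ge0// => i; have [h _ _] := cP p.1; exact: h.
apply: (@le_trans _ _ (\sum_(0 <= k <oo) (V \o f) k)%E) => //.
rewrite nneseries_esumT; last by move=> k; exact: V0.
rewrite -(@reindex_esum _ _ _ setT setT f V)//.
have -> : [set: nat * nat] = [set: nat] `*`` (fun=> [set: nat]) by apply/seteqP; split=> // -[].
rewrite -(esum_esum (a := fun i j => V (i, j))) => [|i j _ _]; last exact: V0.
rewrite -(nneseries_esumT (a := fun i => \esum_(j in [set: nat]) V (i, j))%E); last by move=> k; exact: (esum_ge0 (fun j _ => V0 (k, j))).
apply: lee_nneseries => [k _ _|k _]; first by exact: (esum_ge0 (fun j _ => V0 (k, j))).
by rewrite -nneseries_esumT => [|j]; [have [] := cP k|exact: V0].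
Qed.

HB.instance Definition _ := isOuterMeasure.Build R T louter
  louter0 louter_ge0 louter_mono louter_sigma_subadditive.

Definition shifted (c : T) X : set T := [set x | X (x + c)].

Lemma louter_shifted_le c X : (louter (shifted c X) <= louter X)%E.
Proof.
apply: le_ereal_inf_tmp => _ [a [b [ab Xab ->]]].
apply: le_trans (@louter_le _ (fun k => a k - c) (fun k => b k - c) _ _) _.
- by move=> k i; rewrite !mxE lerD2r.
- move=> x /Xab [k _ xk]; exists k => // i; have := xk i; rewrite !mxE.
  by rewrite lerBlDr lerBrDr.
rewrite le_eqVlt; apply/orP; left; apply/eqP; apply: eq_eseriesr => k _.
by congr (_%:E); apply: eq_bigr => i _; rewrite !mxE opprB addrA subrK.
Qed.

Lemma shiftedK c X : shifted (- c) (shifted c X) = X.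
Proof. by apply/seteqP; split=> x; rewrite /shifted /= subrK. Qed.

Lemma louter_shifted c X : louter (shifted c X) = louter X.
Proof.
apply/eqP; rewrite eq_le louter_shifted_le -{1}(shiftedK c X).
exact: louter_shifted_le.
Qed.

Lemma shifted_measurable c X : louter.-caratheodory X -> louter.-caratheodory (shifted c X).
Proof.
move=> mX Y.
have E Z : Z = shifted c (shifted (- c) Z) by rewrite -{1}(shiftedK (- c) Z) opprK.
rewrite [in LHS](E Y) louter_shifted (mX (shifted (- c) Y)).
rewrite -[in LHS](louter_shifted c) -[X in (_ + X)%E = _](louter_shifted c).
congr (louter _ + louter _)%E; apply/seteqP; split=> x;
  by rewrite /shifted /= ?addrK.
Qed.

Definition unit_vec (i : 'I_n.+1) (c : R) : T := c *: delta_mx 0 i.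

Lemma unit_vecE i c j : unit_vec i c 0 j = if j == i then c else 0.
Proof. by rewrite !mxE eqxx /=; case: eqP; rewrite ?mulr1 ?mulr0. Qed.

Lemma unit_vecN i c : unit_vec i (- c) = - unit_vec i c.
Proof. by rewrite /unit_vec scaleNr. Qed.

(** The difference lies in a slab of thickness [|c|] along the face of the box that the translation
    uncovers. *)
Lemma louter_slab a b i c : (forall j, a 0 j <= b 0 j) ->
  (louter (box a b `\` shifted (unit_vec i c) (box a b)) <=
   (`|c| * \prod_(j < n.+1 | j != i) (b 0 j - a 0 j))%:E)%E.
Proof.
move=> ab.
pose a' : T := \row_j (if j == i then (if 0 <= c then b 0 i - c else a 0 i) else a 0 j).
pose b' : T := \row_j (if j == i then (if 0 <= c then b 0 i else a 0 i - c) else b 0 j).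
have ab' j : a' 0 j <= b' 0 j.
  by rewrite !mxE; case: eqP => // _; case: ifP => c0; lra.
apply: le_trans (louter_mono (_ : _ `<=` box a' b')) _.
  move=> x [xab nx] j; rewrite !mxE; case: (eqVneq j i) => [->{j}|ji]; last exact: xab.
  case: ifP => c0.
    have /andP[x1 ->] := xab i; rewrite andbT leNgt; apply/negP => xc; apply: nx => j.
    rewrite mxE unit_vecE; case: eqP => [->|_]; last by rewrite addr0; exact: xab.
    apply/andP; split; lra.
  have /andP[-> x1] := xab i; rewrite leNgt; apply/negP => xc; apply: nx => j.
  rewrite mxE unit_vecE; case: eqP => [->|_]; last by rewrite addr0; exact: xab.
  move/negbT: c0; rewrite -ltNge => c0; apply/andP; split; lra.
apply: le_trans (louter_box ab') _; rewrite lee_fin /box_volume (bigD1 i)//= !mxE eqxx.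
rewrite le_eqVlt; apply/orP; left; apply/eqP; congr (_ * _).
  case: ifP => c0; first by rewrite ger0_norm//; lra.
  by move/negbT: c0; rewrite -ltNge => c0; rewrite ltr0_norm//; lra.
by apply: eq_bigr => j ji; rewrite !mxE (negbTE ji).
Qed.

Lemma louter_bigcup_lt (F : nat -> set T) N (w : nat -> R) :
  (forall k, (louter (F k) <= (w k)%:E)%E) ->
  (louter (\bigcup_(k in `I_N) F k) <= (\sum_(k < N) w k)%:E)%E.
Proof.
move=> Fw; rewrite bigcup_mkord; apply: le_trans (outer_measure_subadditive _ _ _) _.
by rewrite -sumEFin; apply: lee_sum.
Qed.

Definition symdiff X Y := (X `\` Y) `|` (Y `\` X).

(** [X] is close to a finite union [E] of boxes, for which [louter_slab] applies. The symmetric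
    difference is covered by six small sets: the two differences of [X] and [E], their translates,
    and the two differences of [E] and its translate. *)
Lemma louter_shift_continuous X i (e : R) : louter.-caratheodory X -> (louter X < +oo)%E ->
  0 < e ->
  exists2 eta : R, 0 < eta & forall c, `|c| <= eta ->
    (louter (symdiff X (shifted (unit_vec i c) X)) <= e%:E)%E.
Proof.
move=> mX Xoo e0; pose d := e / 6.
have d0 : 0 < d by rewrite divr_gt0.
have [a [b [ab Xab sum]]] := louter_cover d0 Xoo.
pose V k : \bar R := (box_volume (a k) (b k))%:E.
have V0 k : (0 <= V k)%E by rewrite lee_fin box_volume_ge0.
have Vfin : (\sum_(0 <= k <oo) V k < +oo)%E.
  by apply: le_lt_trans sum _; rewrite lte_add_pinfty// ltry.
have [N tail] : exists N, (\sum_(N <= k <oo) V k <= d%:E)%E.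
  have := nneseries_tail_cvg Vfin (fun k _ => V0 k).
  move/fine_cvgP => [finN cvgN].
  move/cvgrPdist_lt: cvgN => /(_ _ d0) H.
  have [N [h1 h2]] : exists N, (\sum_(N <= k <oo) V k)%E \is a fin_num /\
      `|0 - (fine \o (fun N => \sum_(N <= k <oo) V k)%E) N| < d.
    near \oo => N; exists N; split; near: N; [exact: finN|exact: H].
  exists N; rewrite -(fineK h1) lee_fin; move: h2; rewrite /= sub0r normrN => h2.
  by apply: le_trans (ler_norm _) (ltW h2).
pose E := \bigcup_(k in `I_N) box (a k) (b k).
pose O := \bigcup_k box (a k) (b k).
have XE : (louter (X `\` E) <= d%:E)%E.
  apply: le_trans (louter_mono (_ : _ `<=` \bigcup_(k in ~` `I_N) box (a k) (b k))) _.
    by move=> x [/Xab[k _ xk] nE]; exists k => //= kN; apply: nE; exists k.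
  apply: le_trans (outer_measure_sigma_subadditive_tail _ _ _) _.
  apply: le_trans tail; apply: lee_nneseries => k *; first exact: outer_measure_ge0.
  by apply: louter_box; exact: ab.
(* Here the measurability of [X] is used: it splits the outer measure of the open-ended cover [O]
   additively. *)
have EX : (louter (E `\` X) <= d%:E)%E.
  apply: le_trans (louter_mono (_ : _ `<=` O `&` ~` X)) _.
    by move=> x [[k _ xk] nX]; split=> //; exists k.
  have OX : (louter O <= louter X + d%:E)%E.
    apply: le_trans sum; apply: (@louter_le _ a b) => //.
  have XO : (louter X <= louter (O `&` X))%E by apply: louter_mono => x Xx; split=> //; exact: Xab.
  have fX : louter X \is a fin_num by rewrite ge0_fin_numE ?louter_ge0.
  have := mX O; have := louter_ge0 (O `&` ~` X); move: OX XO.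
  rewrite -(fineK fX); case: (louter O) => [u| |]; case: (louter (O `&` X)) => [p| |];
    case: (louter (O `&` ~` X)) => [q| |] //=.
  rewrite !lee_fin => ? ? ? [?]; lra.
pose W := \sum_(k < N) \prod_(j < n.+1 | j != i) (b k 0 j - a k 0 j).
have W0 : 0 <= W.
  by apply: sumr_ge0 => k _; apply: prodr_ge0 => j _; rewrite subr_ge0 ab.
have EE c : `|c| <= d / (W + 1) -> (louter (E `\` shifted (unit_vec i c) E) <= d%:E)%E.
  move=> cd.
  apply: le_trans (louter_mono (_ : _ `<=` \bigcup_(k in `I_N)
     (box (a k) (b k) `\` shifted (unit_vec i c) (box (a k) (b k))))) _.
    by move=> x [[k kN xk] nE]; exists k => //; split=> // xk'; apply: nE; exists k.
  apply: le_trans (louter_bigcup_lt _ (fun k => louter_slab i c (ab k))) _.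
  rewrite lee_fin -mulr_sumr -/W; move: cd; rewrite ler_pdivlMr; last by lra.
  by have := normr_ge0 c; nra.
exists (d / (W + 1)); first by rewrite divr_gt0//; lra.
move=> c cd; set v := unit_vec i c.
have EE1 := EE c cd.
have EE2 : (louter (shifted v E `\` E) <= d%:E)%E.
  rewrite -(louter_shifted (- v)); have := EE (- c); rewrite normrN unit_vecN => /(_ cd).
  apply: le_trans; apply: louter_mono => x []; rewrite /shifted /= subrK => ? ?; by split.
have XE' : (louter (shifted v (X `\` E)) <= d%:E)%E by rewrite louter_shifted.
have EX' : (louter (shifted v (E `\` X)) <= d%:E)%E by rewrite louter_shifted.
have U A B p q : (louter A <= p%:E)%E -> (louter B <= q%:E)%E -> (louter (A `|` B) <= (p + q)%:E)%E.
  by move=> Ap Bq; apply: le_trans (outer_measureU2 _ _ _) _; rewrite EFinD leeD.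
have -> : e = d + (d + (d + (d + (d + d)))) by rewrite /d; field.
apply: le_trans (U _ _ _ _ XE (U _ _ _ _ EX (U _ _ _ _ XE' (U _ _ _ _ EX' (U _ _ _ _ EE1 EE2))))).
apply: louter_mono => x.
have := pselect (E x); have := pselect (shifted v E x); rewrite /symdiff /setU /setD /shifted /=.
tauto.
Unshelve. all: by end_near. Qed.

End Outer.

(** * Sampling on a translated lattice *)

Lemma sum_measure_le d (R : realType) (T : measurableType d) (mu : {measure set T -> \bar R})
    (I J : finType) (S : I -> set T) (Q : J -> set T) (c : J -> R) :
  (forall i, measurable (S i)) -> (forall j, measurable (Q j)) -> (forall j, 0 <= c j) ->
  (forall t, \sum_i \1_(S i) t <= \sum_j c j * \1_(Q j) t :> R) ->
  (\sum_i mu (S i) <= \sum_j (c j)%:E * mu (Q j))%E.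
Proof.
move=> mS mQ c0 SQ.
have mI (K : set T) : measurable K ->
    measurable_fun [set: T] (EFin \o (\1_K : T -> R)).
  by move=> mK; apply/measurable_EFinP; exact: measurable_indic.
have -> : (\sum_i mu (S i) = \int[mu]_t \sum_i (\1_(S i) t : R)%:E)%E.
  rewrite ge0_integral_sum//; last by move=> i; exact: mI.
  by apply: eq_bigr => i _; rewrite integral_indic// setIT.
have -> : (\sum_j (c j)%:E * mu (Q j) = \int[mu]_t \sum_j (c j)%:E * (\1_(Q j) t : R)%:E)%E.
  rewrite ge0_integral_sum//.
  - by apply: eq_bigr => j _; rewrite ge0_integralZl_EFin ?integral_indic ?setIT//; exact: mI.
  - by move=> j; apply: measurable_funeM; exact: mI.
  - by move=> j t _; rewrite -EFinM lee_fin mulr_ge0.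
apply: ge0_le_integral => //.
- by move=> t _; apply: sume_ge0 => i _; rewrite lee_fin.
- by apply: emeasurable_sum => i; exact: mI.
- by apply: emeasurable_sum => j; apply: measurable_funeM; exact: mI.
move=> t _; rewrite sumEFin (eq_bigr (fun j => (c j * \1_(Q j) t)%:E)) ?sumEFin ?lee_fin//.
Qed.

Section Sampling.
Variables (R : realType) (n : nat).
Local Notation T := 'rV[R]_n.+1.
Local Notation mu := (@louter R n).

Lemma louter_sum_le (I J : finType) (S : I -> set T) (Q : J -> set T) (c : J -> R) :
  (forall i, mu.-caratheodory (S i)) -> (forall j, mu.-caratheodory (Q j)) -> (forall j, 0 <= c j) ->
  (forall t, \sum_i \1_(S i) t <= \sum_j c j * \1_(Q j) t :> R) ->
  (\sum_i mu (S i) <= \sum_j (c j)%:E * mu (Q j))%E.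
Proof.
move=> mS mQ c0 SQ.
pose om : {outer_measure set T -> \bar R} := mu.
exact: (@sum_measure_le _ R (caratheodory_type om) (om : set (caratheodory_type om) -> \bar R) I J S Q c mS mQ c0 SQ).
Qed.

(** If every [t] failed, either the hits would be fewer than [#|G| / Y] or the errors would exceed
    [q * #|G|]. Weighted indicators of [V0] and of the sets [Bd] would then bound the number of hits
    pointwise, and integration over [t] contradicts the bound on [a]. *)
Lemma sampling (G : finType) (x : G -> T) (A V : set T) (Om : finType) (c : Om -> R)
    (Bd : Om -> set T) (Y : nat) (q a v eps : R) :
  mu.-caratheodory A -> (forall w, mu.-caratheodory (Bd w)) -> (forall w, 0 <= c w) ->
  (0 < #|G|)%N -> (0 < Y)%N -> 0 < q ->
  (forall k, shifted (x k) A `<=` V) -> (mu V <= v%:E)%E ->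
  (forall w, (mu (Bd w) <= eps%:E)%E) ->
  mu A = a%:E -> v / Y%:R + (\sum_w c w) * eps / q < a ->
  exists t : T, (#|G| <= Y * #|[set k | `[< A (t + x k)%R >]]%SET|)%N /\
    \sum_w c w * \sum_k (\1_(Bd w) (t + x k) : R) <= q * #|G|%:R.
Proof.
move=> mA mB c0 G0 Y0 q0 AV Vv Be Aa lt_a.
have YR : 0 < Y%:R :> R by rewrite ltr0n.
have GR : 0 < #|G|%:R :> R by rewrite ltr0n.
apply: contrapT => none.
(* This finite union of translates of [A] is measurable and stands in for [V] under the integral. *)
pose V0 := \bigcup_(k in [set: G]) shifted (x k) A.
have mV0 : mu.-caratheodory V0.
  pose om : {outer_measure set T -> \bar R} := mu.
  apply: (@fin_bigcup_measurable _ (caratheodory_type om)) => [|k _]; first exact: finite_finset.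
  exact: shifted_measurable.
have V0v : (mu V0 <= v%:E)%E.
  apply: le_trans Vv; apply: le_outer_measure => t [k _]; exact: AV.
pose Q (j : 'I_1 + Om * G) := if j is inr p then shifted (x p.2) (Bd p.1) else V0.
pose cc (j : 'I_1 + Om * G) := if j is inr p then c p.1 / q else #|G|%:R / Y%:R.
have := @louter_sum_le G ('I_1 + Om * G)%type (fun k => shifted (x k) A) Q cc.
move=> /(_ (fun k => shifted_measurable (x k) mA)).
have mQ j : mu.-caratheodory (Q j) by case: j => [i|p] //; exact: shifted_measurable.
have cc0 j : 0 <= cc j by case: j => [i|p]; rewrite /cc divr_ge0// ltW.
move=> /(_ mQ cc0).
have sum_split (M : nmodType) (F : 'I_1 + Om * G -> M) :
    \sum_j F j = F (inl ord0) + \sum_w \sum_k F (inr (w, k)).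
  by rewrite big_sumType big_ord1 pair_bigA; congr (_ + _); apply: eq_bigr => -[].
have H t : \sum_k \1_(shifted (x k) A) t <= \sum_j cc j * \1_(Q j) t :> R.
  rewrite sum_split /=.
  pose S := [set k | `[< A (t + x k)%R >]]%SET.
  have -> : \sum_k \1_(shifted (x k) A) t = #|S|%:R :> R.
    rewrite -sum1_card natr_sum [RHS]big_mkcond /=; apply: eq_bigr => k _.
    rewrite inE indicE /shifted; case: asboolP => h; first by rewrite mem_set.
    by rewrite memNset.
  pose Err := \sum_w c w * \sum_k (\1_(Bd w) (t + x k) : R).
  have -> : \sum_w \sum_k c w / q * \1_(shifted (x k) (Bd w)) t = Err / q.
    rewrite /Err mulr_suml; apply: eq_bigr => w _; rewrite mulrAC mulr_sumr.
    by apply: eq_bigr => k _; rewrite !indicE.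
  have Err0 : 0 <= Err by apply: sumr_ge0 => w _; rewrite mulr_ge0// sumr_ge0.
  have SG : #|S|%:R <= #|G|%:R :> R by rewrite ler_nat max_card.
  (* With large errors, [Err / q] alone exceeds [#|G|]; otherwise [t] has few hits, and any hit
     places it in [V0]. *)
  have [big|small] := ltP (q * #|G|%:R) Err.
    apply: le_trans SG _; apply: (@le_trans _ _ (Err / q)).
      by rewrite ler_pdivlMr// mulrC ltW.
    by rewrite lerDr mulr_ge0// divr_ge0.
  have SY : (Y * #|S| < #|G|)%N.
    by rewrite ltnNge; apply/negP => h; apply: none; exists t.
  have [S0|Sp] := posnP #|S|.
    by rewrite S0 indicE; apply: addr_ge0; [rewrite mulr_ge0 ?divr_ge0|rewrite divr_ge0 ?(ltW q0)].
  have tV : V0 t.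
    by have /card_gt0P[k] := Sp; rewrite inE => /asboolP h; exists k.
  rewrite indicE mem_set// mulr1 (le_trans (_ : _ <= #|G|%:R / Y%:R))//.
    by rewrite ler_pdivlMr// mulrC -natrM ler_nat ltnW.
  by rewrite lerDl divr_ge0// ltW.
move=> /(_ H).
have -> : (\sum_k mu (shifted (x k) A) = (#|G|%:R * a)%:E)%E.
  rewrite (eq_bigr (fun=> a%:E)); last by move=> k _; rewrite -Aa louter_shifted.
  by rewrite sumEFin sumr_const mulr_natl.
apply/negP; rewrite -ltNge sum_split /=.
apply: (@le_lt_trans _ _ ((#|G|%:R / Y%:R * v + \sum_w \sum_(k : G) c w / q * eps)%:E)).
  rewrite EFinD; apply: leeD; first by rewrite [leRHS]EFinM lee_wpmul2l// lee_fin divr_ge0.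
  rewrite -sumEFin; apply: lee_sum => w _; rewrite -sumEFin; apply: lee_sum => k _.
  by rewrite [leRHS]EFinM lee_wpmul2l ?lee_fin ?divr_ge0 ?louter_shifted// ltW.
rewrite lte_fin.
have -> : \sum_w \sum_(k : G) c w / q * eps = #|G|%:R * ((\sum_w c w) * eps / q).
  rewrite !mulr_suml mulr_sumr; apply: eq_bigr => w _; rewrite sumr_const -[LHS]mulr_natl.
  by congr (_ * _); rewrite mulrAC.
have -> : #|G|%:R / Y%:R * v = #|G|%:R * (v / Y%:R) by rewrite mulrAC mulrA.
by rewrite -mulrDr ltr_pM2l.
Qed.
End Sampling.

(** * The measure of a cube *)

Section CubeVolume.
Variable R : realType.

(* The selection [P] lets the induction discard the boxes that miss a given slice. *)
Lemma cover_volume (n : nat) (L : R) (P : nat -> bool) (a b : nat -> nat -> R) :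
  0 <= L -> (forall k i, a k i <= b k i) ->
  (forall x : nat -> R, (forall i, 0 <= x i <= L) ->
     exists2 k, P k & forall i, (i < n)%N -> a k i <= x i <= b k i) ->
  ((L ^+ n)%:E <= \sum_(0 <= k <oo)
     (if P k then \prod_(i < n) (b k i - a k i) else 0)%:E)%E.
Proof.
move=> L0 ab; elim: n P => [|n IH] P cov.
  have [k Pk _] := cov (fun=> 0) (fun=> ltac:(by rewrite lexx)).
  rewrite expr0; apply: le_trans (_ : _ <= \sum_(0 <= j < k.+1) (if P j then \prod_(i < 0) (b j i - a j i) else 0)%:E)%E _.
    rewrite big_nat_recr//= Pk big_ord0 leeDr// sume_ge0// => j _.
    by rewrite lee_fin; case: ifP; rewrite ?big_ord0.
  apply: nneseries_lim_ge => j _ _; by rewrite lee_fin; case: ifP; rewrite ?big_ord0.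
pose c k := if P k then \prod_(i < n) (b k i - a k i) else 0.
have c0 k : 0 <= c k.
  by rewrite /c; case: ifP => // _; apply: prodr_ge0 => i _; rewrite subr_ge0.
pose f k (t : R) : \bar R := (c k * \1_(`[a k n, b k n]%classic) t)%:E.
have f0 k t : (0 <= f k t)%E by rewrite lee_fin mulr_ge0// indicE.
have mI k : measurable (`[a k n, b k n]%classic : set R) by exact: measurable_itv.
have mf k (D : set R) : measurable_fun D (f k).
  apply/measurable_EFinP; apply: measurable_funM => //; exact: measurable_indic.
pose mu := @lebesgue_measure R.
have muI u v : mu `[u, v]%classic = (if u < v then v - u else 0)%:E.
  rewrite /mu lebesgue_measure_itv /= lte_fin; case: ifP => //.
have mD : measurable (`[0, L]%classic : set R) by exact: measurable_itv.
have slice t : `[0, L]%classic t -> ((L ^+ n)%:E <= \sum_(0 <= k <oo) f k t)%E.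
  rewrite /= in_itv /= => tL.
  apply: le_trans (IH (fun k => P k && (a k n <= t <= b k n)) _) _.
    move=> x xL; have [|k Pk kx] := cov (fun i => if i == n then t else x i).
      by move=> i; case: eqP.
    exists k.
      by rewrite Pk; have := kx n (ltnSn n); rewrite eqxx.
    by move=> i ni; have := kx i (ltnW ni); rewrite (ltn_eqF ni).
  apply: lee_nneseries => [k _ _|k _].
    by rewrite lee_fin; case: ifP => // _; apply: prodr_ge0 => i _; rewrite subr_ge0.
  rewrite lee_fin /c indicE; case: (P k) => /=; last by rewrite mul0r.
  case: ifP => h; first by rewrite mem_set ?mulr1//= in_itv.
  by rewrite mulr_ge0// prodr_ge0// => i _; rewrite subr_ge0.
have lhs : (\int[mu]_(t in `[0%R, L]) (L ^+ n)%:E = (L ^+ n.+1)%:E)%E.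
  rewrite integral_cst// [X in (_ * X)%E](muI 0 L).
  move: L0; rewrite le_eqVlt => /orP[/eqP <-|L0]; first by rewrite ltxx mule0 expr0n.
  by rewrite L0 subr0 -EFinM exprSr.
rewrite -lhs; apply: le_trans (_ : _ <= \int[mu]_(t in `[0%R, L]) (\sum_(0 <= k <oo) f k t))%E _.
  apply: ge0_le_integral => //.
  - by move=> t _; rewrite lee_fin exprn_ge0.
  - by apply: ge0_emeasurable_sum => // k _; exact: mf.
rewrite integral_nneseries//; last by move=> k; exact: mf.
apply: lee_nneseries => [k _ _|k _]; first by apply: integral_ge0 => t _; exact: f0.
rewrite /f; under eq_integral do rewrite EFinM.
rewrite ge0_integralZl_EFin//; last first.
  by apply/measurable_EFinP; exact: measurable_indic.
rewrite integral_indic//.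
have -> : (if P k then \prod_(i < n.+1) (b k i - a k i) else 0) = c k * (b k n - a k n).
  by rewrite /c; case: ifP => _; rewrite ?mul0r// big_ord_recr.
rewrite EFinM lee_wpmul2l// ?lee_fin//.
apply: (@le_trans _ _ (mu `[a k n, b k n]%classic)).
  by apply: le_measure; rewrite ?inE//; exact: measurableI.
rewrite muI lee_fin; case: ifP => // _; by rewrite subr_ge0.
Qed.

Lemma cube_volume (n : nat) (L : R) : 0 <= L -> ((L ^+ n.+1)%:E <= louter (cube n.+1 L))%E.
Proof.
move=> L0; apply: le_ereal_inf_tmp => _ [a [b [ab cov ->]]].
have := @cover_volume n.+1 L xpredT (fun k i => a k 0 (inord i)) (fun k i => b k 0 (inord i)) L0.
move=> /(_ (fun k i => ab k (inord i))) /=.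
have E k : \prod_(i < n.+1) (b k 0 (inord i) - a k 0 (inord i)) = box_volume (a k) (b k).
  by apply: eq_bigr => i _; rewrite inord_val.
under eq_eseriesr do rewrite E.
apply => x xL.
have [|k _ kx] := cov (\row_i x i); first by move=> i; rewrite !mxE.
exists k => // i ni; have := kx (inord i); rewrite mxE inordK//.
Qed.

End CubeVolume.

(** * The simplex with given edges *)

Section Simplex.
Variables (R : realType) (n r : nat).
Hypothesis rn : (r.+2 <= n.+1)%N.
Local Notation T := 'rV[R]_n.+1.
Variables (l : nat -> R) (c d ell : R).
Hypothesis l_gt0 : forall i, 0 < l i.
Hypothesis ell_gt0 : 0 < ell.
Hypothesis ellE : c ^+ 2 + d ^+ 2 = ell ^+ 2.

Definition edges : 'M[R]_(r.+1, n.+1) :=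
  \matrix_(i, j) (if (i < r)%N then (if j == i :> nat then l i else 0)
     else if j == r :> nat then c else if j == r.+1 :> nat then d else 0).

Lemma row_edges_lt (i : 'I_r.+1) : (i < r)%N ->
  row i edges = unit_vec (inord i : 'I_n.+1) (l i).
Proof.
move=> ir; apply/rowP => j; rewrite unit_vecE !mxE ir.
by rewrite -val_eqE /= inordK//; apply: leq_trans rn; rewrite ltnS ltnW// ltnW.
Qed.

Lemma row_edges_last (i : 'I_r.+1) : ~~ (i < r)%N ->
  row i edges = unit_vec (inord r : 'I_n.+1) c + unit_vec (inord r.+1 : 'I_n.+1) d.
Proof.
move=> ir; apply/rowP => j; rewrite [in RHS]mxE !unit_vecE !mxE (negbTE ir).
rewrite -!val_eqE /= !inordK//; last by apply: ltnW.
case: eqP => [->|_]; last by rewrite add0r.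
by rewrite (ltn_eqF (ltnSn r)) addr0.
Qed.

Lemma dotC (u v : T) : dot u v = dot v u.
Proof. by apply: eq_bigr => i _; rewrite mulrC. Qed.

Lemma dot_unit_vecl i a (v : T) : dot (unit_vec i a) v = a * v 0 i.
Proof.
rewrite /dot (bigD1 i)//= unit_vecE eqxx big1 ?addr0// => j /negbTE ji.
by rewrite unit_vecE ji mul0r.
Qed.

Lemma dotDl (u v w : T) : dot (u + v) w = dot u w + dot v w.
Proof. by rewrite /dot -big_split; apply: eq_bigr => i _; rewrite mxE mulrDl. Qed.

Lemma edges_orthogonal (i j : 'I_r.+1) : i != j -> dot (row i edges) (row j edges) = 0.
Proof.
wlog ij : i j / (i < j)%N.
  move=> W ij; have := ij; rewrite neq_ltn => /orP[h|h]; first exact: W.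
  by rewrite dotC; apply: W => //; rewrite eq_sym.
move=> _; have jr : (j <= r)%N by rewrite -ltnS.
have ir : (i < r)%N by apply: leq_trans jr.
rewrite row_edges_lt// dot_unit_vecl !mxE inordK; last first.
  by apply: leq_trans rn; rewrite ltnS ltnW// ltnW.
case: ifP => _; first by rewrite (ltn_eqF ij) mulr0.
by rewrite (ltn_eqF ir) (ltn_eqF (ltnW ir : (i < r.+1)%N)) mulr0.
Qed.

Lemma edges_length (i : 'I_r.+1) :
  euclidean_length (row i edges) = if (i < r)%N then l i else ell.
Proof.
rewrite /euclidean_length; case: ifP => ir.
  rewrite row_edges_lt// dot_unit_vecl unit_vecE eqxx -expr2 sqrtr_sqr ger0_norm//.
  exact: ltW.
rewrite row_edges_last ?ir// dotDl !dot_unit_vecl.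
have rr : ((inord r : 'I_n.+1) == inord r.+1) = false.
  by rewrite -val_eqE /= !inordK//; [exact: ltn_eqF|exact: ltnW].
have addE (u v : T) j : (u + v) 0 j = u 0 j + v 0 j by rewrite mxE.
rewrite !addE !unit_vecE !eqxx rr eq_sym rr addr0 add0r -!expr2 ellE.
by rewrite sqrtr_sqr ger0_norm// ltW.
Qed.

(** The Gram matrix of the rows is diagonal with nonzero entries: pairing a kernel vector with row
    [i] shows that its coordinate [i] vanishes. *)
Lemma edges_right_angled : right_angled edges.
Proof.
split; last exact: edges_orthogonal.
rewrite -kermx_eq0; apply/eqP/row_matrixP => k; rewrite row0.
set v := row k _; have vE : v *m edges = 0.
  by apply/eqP; rewrite -sub_kermx row_sub.
apply/rowP => i; rewrite [RHS]mxE.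
have : dot (v *m edges) (row i edges) = 0.
  by rewrite vE /dot big1// => j _; rewrite mxE mul0r.
have -> : dot (v *m edges) (row i edges) = \sum_k' v 0 k' * dot (row k' edges) (row i edges).
  rewrite /dot; under eq_bigr do rewrite mxE mulr_suml.
  rewrite exchange_big /=; apply: eq_bigr => k' _; rewrite mulr_sumr.
  by apply: eq_bigr => j _; rewrite !mxE mulrA.
rewrite (bigD1 i)//= big1 ?addr0; last by move=> j ji; rewrite edges_orthogonal ?mulr0.
move/eqP; rewrite mulf_eq0 => /orP[/eqP//|/eqP d0].
have := edges_length i; rewrite /euclidean_length d0 sqrtr0.
by case: ifP => _ h; [have := l_gt0 i|have := ell_gt0]; rewrite -h ltxx.
Qed.

Lemma edges_volume : (\prod_(i < r) l i) * ell = (r.+1`!)%:R -> right_angled_volume edges = 1.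
Proof.
move=> H; rewrite /right_angled_volume big_ord_recr /= edges_length ltnn.
under eq_bigr do rewrite edges_length /= ltn_ord.
by rewrite H divff// pnatr_eq0 -lt0n fact_gt0.
Qed.

Lemma edges_vertices (p : T) (A : set T) : A p ->
  (forall i, (i < r)%N -> A (p + unit_vec (inord i) (l i))) ->
  A (p + (unit_vec (inord r) c + unit_vec (inord r.+1) d)) ->
  simplex_vertices p edges `<=` A.
Proof.
move=> Ap Al Acd _ [->//|[i _ <-]].
case: (boolP (i < r)%N) => ir; first by rewrite row_edges_lt//; exact: Al.
by rewrite row_edges_last.
Qed.

Lemma edges_axis_adapted : axis_adapted edges.
Proof.
move=> i; case: ifP => /= ir.
  exists (inord i); first by rewrite inordK//; apply: leq_trans rn; rewrite ltnS ltnW// ltnW.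
  by rewrite row_edges_lt// /unit_vec scalemx_sub.
rewrite row_edges_last ?ir//.
have sub k e : (r <= k <= r.+1)%N ->
    (unit_vec (inord k : 'I_n.+1) e <= \sum_(j < n.+1 | (r <= j)%N) <<(delta_mx 0 j : T)>>)%MS.
  move=> /andP[rk kr]; have kn : (k < n.+1)%N by apply: leq_ltn_trans kr _.
  rewrite scalemx_sub// (sumsmx_sup (inord k))//; first by rewrite inordK.
  by rewrite genmxE.
by rewrite addmx_sub ?sub ?leqnn ?leqnSn.
Qed.

End Simplex.

(** * Lattice points *)

(* The sampled lattice is a torus of side at least [3 * L]: a step shorter than [2 * L]
   between two of its points in the cube [0, L]^n is a genuine translation. *)
Lemma no_wraparound (R : realType) (H : nat) (a v : 'I_H.+1) (w : nat) (h L : R) :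
  val v = (w %% H.+1)%N -> 0 < h -> 3 * L <= h * H.+1%:R -> h * w%:R < 2 * L ->
  `|h * ((a + v)%R : 'I_H.+1)%:R - h * a%:R| <= L ->
  h * ((a + v)%R : 'I_H.+1)%:R = h * a%:R + h * w%:R.
Proof.
move=> vw h0 hH hw.
have wH : (w < H.+1)%N.
  rewrite -(ltr_nat R) -(ltr_pM2l h0); have : 0 <= h * w%:R by rewrite mulr_ge0// ltW.
  by lra.
have -> : nat_of_ord (a + v)%R = ((a + w) %% H.+1)%N by rewrite /= vw modnDmr.
have [aw|aw] := ltnP (a + w) H.+1; first by rewrite modn_small// natrD mulrDr.
have aH := ltn_ord a.
have -> : ((a + w) %% H.+1)%N = (a + w - H.+1)%N.
  by rewrite -[in LHS](subnK aw) modnDr modn_small//; lia.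
rewrite natrB// natrD mulrBr mulrDr ler_norml => /andP[h1 _].
suff : 2 * L <= h * w%:R by rewrite leNgt hw.
lra.
Qed.

Lemma arc_size_le (R : realType) (P : nat) (Lam : R) : (0 < P)%N -> 0 <= Lam ->
  (4 * arc_size P Lam)%:R <= Lam.
Proof.
move=> P0 L0; rewrite /arc_size mulnA natrM mulrC.
have PP : 0 < (4 * P ^ 2)%:R :> R by rewrite ltr0n muln_gt0 expn_gt0 P0.
rewrite -ler_pdivlMr//; have /andP[//] := truncnE (divr_ge0 L0 (ltW PP)).
Qed.

Section Lattice.
Variables (R : realType) (n r H : nat) (h : R).
Hypothesis rn : (r.+2 <= n.+1)%N.
Hypothesis H_gt0 : (0 < H)%N.
Hypothesis h_gt0 : 0 < h.
Local Notation T := 'rV[R]_n.+1.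
Local Notation G := 'rV['I_H.+1]_r.+2.

(** The remaining coordinates stay 0: the torus has dimension [r.+2] whatever [n] is. *)
Definition lattice_pt (k : G) : T :=
  \row_(i < n.+1) (if (i < r.+2)%N then h * (k 0 (inord i) : nat)%:R else 0).

Definition gen (i : 'I_r.+2) : G := \row_j (if j == i then inord 1 else 0).

Lemma gen_mul i z j : val ((gen i *+ z) 0 j) = ((if j == i then z else 0) %% H.+1)%N.
Proof.
rewrite mulmxnE mxE; case: eqP => _; last by rewrite mul0rn mod0n.
by rewrite Zp_mulrn /= inordK// mul1n.
Qed.

Lemma lattice_shift (L : R) (t : T) (k v : G) (w : 'I_r.+2 -> nat) :
  3 * L <= h * H.+1%:R ->
  (forall j, val (v 0 j) = (w j %% H.+1)%N) -> (forall j, h * (w j)%:R < 2 * L) ->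
  cube n.+1 L (t + lattice_pt k) -> cube n.+1 L (t + lattice_pt (k + v)) ->
  t + lattice_pt (k + v) = t + lattice_pt k +
    \row_(i < n.+1) (if (i < r.+2)%N then h * (w (inord i))%:R else 0).
Proof.
move=> hH vw hw c1 c2; rewrite -addrA; congr (t + _); apply/rowP => i; rewrite !mxE.
case: ifP => ir; last by rewrite addr0.
apply: (@no_wraparound _ _ _ _ _ h L) => //.
have /andP[] := c1 i; have /andP[] := c2 i; rewrite !mxE ir ler_norml => *.
apply/andP; split; lra.
Qed.

Lemma lattice_shift_unit (L : R) (t : T) (k : G) (i : nat) z : (i < r.+2)%N ->
  3 * L <= h * H.+1%:R -> 0 <= L -> h * z%:R < 2 * L ->
  cube n.+1 L (t + lattice_pt k) -> cube n.+1 L (t + lattice_pt (k + gen (inord i) *+ z)) ->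
  t + lattice_pt (k + gen (inord i) *+ z) = t + lattice_pt k + unit_vec (inord i) (h * z%:R).
Proof.
move=> ir hH L0 hz c1 c2.
rewrite (@lattice_shift L t k _ (fun j => if j == inord i then z else 0%N))//.
- congr (_ + _); apply/rowP => j; rewrite unit_vecE mxE -!val_eqE /= (@inordK n); last by apply: leq_trans rn.
  case: ifP => jr; last first.
    by case: eqP => // E; rewrite E ir in jr.
  by rewrite !inordK//; case: eqP => _; rewrite ?mulr0.
- by move=> j; exact: gen_mul.
- move=> j; case: eqP => // _; rewrite mulr0.
  have : 0 <= h * z%:R by rewrite mulr_ge0 ?ler0n ?(ltW h_gt0).
  by lra.
Qed.

Lemma lattice_shift_pair (L : R) (t : T) (k : G) (i1 i2 : nat) z1 z2 :
  (i1 < r.+2)%N -> (i2 < r.+2)%N -> i1 != i2 ->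
  3 * L <= h * H.+1%:R -> h * z1%:R < 2 * L -> h * z2%:R < 2 * L ->
  cube n.+1 L (t + lattice_pt k) ->
  cube n.+1 L (t + lattice_pt (k + (gen (inord i1) *+ z1 + gen (inord i2) *+ z2))) ->
  t + lattice_pt (k + (gen (inord i1) *+ z1 + gen (inord i2) *+ z2)) =
  t + lattice_pt k + (unit_vec (inord i1) (h * z1%:R) + unit_vec (inord i2) (h * z2%:R)).
Proof.
move=> ir1 ir2 i12 hH hz1 hz2 c1 c2.
rewrite (@lattice_shift L t k _ (fun j => if j == inord i1 then z1 else if j == inord i2 then z2 else 0%N))//.
- congr (_ + _); apply/rowP => j; rewrite [in RHS]mxE !unit_vecE mxE -!val_eqE /= !(@inordK n); last 2 first.
  + exact: leq_trans rn.
  + exact: leq_trans rn.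
  case: ifP => jr; last first.
    case: eqP => E1; first by rewrite E1 ir1 in jr.
    case: eqP => E2; first by rewrite E2 ir2 in jr.
    by rewrite addr0.
  rewrite !inordK//; case: eqP => E1.
    by rewrite -E1 in i12; rewrite (negbTE i12) addr0.
  by rewrite add0r; case: eqP => _; rewrite ?mulr0.
- move=> j; have -> : val ((gen (inord i1) *+ z1 + gen (inord i2) *+ z2) 0 j) =
    ((val ((gen (inord i1) *+ z1) 0%R j) + val ((gen (inord i2) *+ z2) 0%R j)) %% H.+1)%N by rewrite mxE.
  rewrite !gen_mul modnDm; case: (eqVneq j (inord i1)) => [->|_]; last by rewrite add0n.
  by rewrite -val_eqE /= !inordK// (negbTE i12) addn0.
- have : 0 <= h * z1%:R by rewrite mulr_ge0// ltW.
  move=> h1 j; case: eqP => // _; case: eqP => // _; rewrite mulr0; lra.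
Qed.

End Lattice.

(** * From a dense subset of the cube to a simplex *)

Definition has_simplex (R : realType) (m n : nat) (A : set 'rV[R]_n) :=
  exists (p : 'rV[R]_n) (E : 'M[R]_(m, n)),
    [/\ right_angled E, right_angled_volume E = 1,
        simplex_vertices p E `<=` A & axis_adapted E].

Lemma symdiff_shifted (R : realType) (n : nat) (v w : 'rV[R]_n.+1) A :
  louter (symdiff (shifted v A) (shifted w A)) = louter (symdiff A (shifted (w - v) A)).
Proof.
rewrite -[RHS](louter_shifted v); congr louter.
have E x : x + v + (w - v) = x + w by rewrite (addrC w) addrA addrK.
by apply/seteqP; split=> x; rewrite /symdiff /shifted /setU /setD /= E.
Qed.

(** An enlarged side [L + K] is at most [5 * L]. Only the discretised coordinates are enlarged, so
    the loss is independent of the dimension of the space. *)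
Lemma box_volume_slab (R : realType) (n r : nat) (L K : R) : (r <= n)%N ->
  0 <= L -> 0 <= K <= 4 * L ->
  box_volume (\row_(i < n) (if (i < r)%N then - K else 0)) (const_mx L) <= 5 ^+ r * L ^+ n.
Proof.
move=> rn L0 /andP[K0 KL]; rewrite /box_volume.
have -> : 5 ^+ r * L ^+ n = \prod_(i < n) ((if (i < r)%N then 5 else 1) * L).
  rewrite big_split /= prodr_const card_ord -big_mkcond /=; congr (_ * _).
  by rewrite -(big_ord_widen n (fun=> 5 : R) rn) prodr_const card_ord.
apply: ler_prod => i _; rewrite !mxE; case: ifP => _; apply/andP; split; lra.
Qed.

Lemma sum_tagged (R : nmodType) (I : finType) (J : I -> finType) (F : {i : I & J i} -> R) :
  \sum_w F w = \sum_(i : I) \sum_(j : J i) F (Tagged J j).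
Proof.
by rewrite (sig_big_dep xpredT (fun _ => xpredT) (fun i (j : J i) => F (Tagged J j))); apply: eq_bigr => -[].
Qed.

Section DensePattern.
Variables (R : realType) (n r : nat).
Hypothesis rn : (r.+2 <= n.+1)%N.
Local Notation T := 'rV[R]_n.+1.
Local Notation mu := (@louter R n).

(** The default value 1 keeps all lengths positive, as the lemmas on [edges] demand. *)
Definition lengths (M step : nat) (h : R) (j : {ffun 'I_r -> 'I_M}) (i : nat) : R :=
  if insub i is Some k then h * (step * (j k : 'I_M).+1)%:R else 1.

Lemma lengthsE M step h (j : {ffun 'I_r -> 'I_M}) (i : 'I_r) :
  lengths step h j i = h * (step * (j i).+1)%:R.
Proof. by rewrite /lengths valK. Qed.

Lemma lengths_gt0 M step h (j : {ffun 'I_r -> 'I_M}) i :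
  0 < h -> (0 < step)%N -> 0 < lengths step h j i.
Proof.
move=> h0 s0; rewrite /lengths; case: insubP => // k _ _.
by rewrite mulr_gt0// ltr0n muln_gt0 s0.
Qed.

Lemma lengths_volume (b D s step M : nat) (h : R) (j : {ffun 'I_r -> 'I_M}) :
  h * D%:R = 1 -> (step * b ^ s.+1 = D)%N ->
  (\prod_(i < r) lengths step h j i) * (h * radius R b D s j) = (r.+1`!)%:R.
Proof.
move=> hD sD.
have p0 : (\prod_i (j i).+1)%:R != 0 :> R by rewrite pnatr_eq0 -lt0n; exact: prodn_gt0.
under eq_bigr do rewrite lengthsE natrM mulrA.
rewrite big_split /= prodr_const card_ord -natr_prod /radius card_ord.
have -> : (h * step%:R) ^+ r * (\prod_(i < r) (j i).+1)%:R * (h * ((r.+1`! * b ^ (s.+1 * r) * D)%:R / (\prod_i (j i).+1)%:R)) =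
   r.+1`!%:R * ((h * (step * b ^ s.+1)%:R) ^+ r) * (h * D%:R).
  rewrite expnM natrM !natrM natrX; set p := (\prod_i _)%:R in p0 *.
  rewrite !exprMn -natrX; field; exact: p0.
by rewrite sD hD expr1n !mulr1.
Qed.

(** The scale and the short edges are known only after [t], so the rounding errors of all pairs
    [(s, j)] are controlled simultaneously. Without a simplex, every configuration found in the
    lattice would be such an error, and there are too many of them. *)
Lemma dense_pattern (L a : R) (A : set T) (Y P S b : nat) :
  let X := (2 * #|'I_r| * Y)%N in
  (0 < r)%N -> 1 <= L -> A `<=` cube n.+1 L -> mu.-caratheodory A -> mu A = a%:E ->
  0 < a -> (0 < Y)%N -> 2 * 5 ^+ r.+2 * L ^+ n.+1 <= Y%:R * a ->
  (1 < P)%N -> (32 * X ^ (4 * #|'I_r|.+1) <= S)%N ->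
  64 * 536 * (X ^ (4 * #|'I_r|.+1))%:R <= P%:R :> R ->
  (4 * P ^ 6 * X <= b)%N -> (r.+1`! * b ^ (S * r))%:R <= L ->
  has_simplex r.+1 A.
Proof.
move=> X r0 L1 AL mA Aa a0 Y0 YA P1 XS XP Xb bL.
have cr : #|'I_r| = r by exact: card_ord.
have X0 : (0 < X)%N by rewrite /X cr !muln_gt0 r0.
have P0 : (0 < P)%N by lia.
have XbX : (X <= b)%N.
  by apply: leq_trans Xb; rewrite leq_pmull// muln_gt0 expn_gt0 P0.
have b0 : (0 < b)%N by apply: leq_trans XbX.
have L0 : 0 < L by lra.
set Pi := ('I_S * {ffun 'I_r -> 'I_X})%type.
pose C0 : R := #|{: Pi}|%:R.
pose Xm : R := (X ^ (2 * #|'I_r|.+1))%:R.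
have Xm0 : 0 < Xm by rewrite ltr0n expn_gt0 X0.
(* Half of the proportion guaranteed by [discrete_pattern]; the next choice, [eps], keeps the error
   term of [sampling] at most [a / 4]. *)
pose q : R := Xm^-1 / 4.
have q0 : 0 < q by rewrite divr_gt0// invr_gt0.
pose eps := a * q / (4 * (C0 + 1)).
have C00 : 0 <= C0 by rewrite ler0n.
have eps0 : 0 < eps by rewrite divr_gt0// mulr_gt0//; lra.
have Aoo : (mu A < +oo)%E by rewrite Aa ltry.
have [eta eta0 Heta] := louter_shift_continuous (inord r.+1) mA Aoo eps0.
(* Two demands on the mesh: [1 + P ^ 2] lattice units are at most [eta], and the vertical run that
   thickens the arc is shorter than 1. *)
pose W := maxn (Num.truncn ((1 + P ^ 2)%:R / eta)).+1 (P ^ 2).+1.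
have W1 : (1 + P ^ 2)%:R / eta <= W%:R.
  apply: (@le_trans _ _ (Num.truncn ((1 + P ^ 2)%:R / eta)).+1%:R); last by rewrite ler_nat leq_maxl.
  by apply: ltW; exact: truncnS_gt.
have W2 : (P ^ 2 < W)%N by rewrite /W leq_max ltnSn orbT.
have W0 : (0 < W)%N by apply: leq_ltn_trans W2.
(* A multiple of [b ^ s.+1] for every [s < S], so that the short edges have length exactly
   [(j i).+1 / b ^ s.+1]. *)
pose D := (b ^ S * W)%N.
have D0 : (0 < D)%N by rewrite muln_gt0 expn_gt0 b0.
have DR : 0 < D%:R :> R by rewrite ltr0n.
have WD : (W <= D)%N by rewrite leq_pmull// expn_gt0 b0.
pose h : R := D%:R^-1.
have h0 : 0 < h by rewrite invr_gt0.
have hD : h * D%:R = 1 by rewrite mulVf// gt_eqF.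
(* The side of the torus: at least [3 * L] to exclude wraparound, at most [4 * L] for
   [box_volume_slab]. *)
pose K := (Num.truncn (3 * L)).+1.
have K1 : 3 * L <= K%:R by apply: ltW; exact: truncnS_gt.
have K2 : K%:R <= 4 * L.
  have L3 : 0 <= 3 * L by lra.
  by rewrite /K -natr1; have /andP[] := truncnE L3; lra.
pose H := (K * D).-1.
have KD0 : (0 < K * D)%N by rewrite muln_gt0 D0.
have HE : H.+1 = (K * D)%N by rewrite /H prednK.
have K3 : (3 <= K)%N by rewrite -(ler_nat R); lra.
have H0 : (0 < H)%N by rewrite -ltnS HE; apply: (@leq_trans (3 * 1)) => //; apply: leq_mul.
have hH : h * H.+1%:R = K%:R by rewrite HE natrM mulrCA hD mulr1.
have hH3 : 3 * L <= h * H.+1%:R by rewrite hH.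
pose G : finZmodType := 'rV['I_H.+1]_r.+2.
pose x (k : G) : T := lattice_pt n h k.
pose Lamb (p : Pi) : R := radius R b D p.1 p.2.
have Lamb0 p : 0 < Lamb p.
  rewrite /Lamb /radius divr_gt0// ltr0n; last exact: prodn_gt0.
  by rewrite muln_gt0 D0 andbT muln_gt0 fact_gt0 expn_gt0 b0.
have hLamb p : h * Lamb p <= L.
  apply: le_trans bL; have [_ le] := @radius_bounds R _ b D p.1 X p.2.
  apply: (@le_trans _ _ (h * (#|'I_r|.+1`! * b ^ (p.1.+1 * #|'I_r|) * D)%:R)).
    by rewrite ler_wpM2l// ltW.
  rewrite natrM mulrCA hD mulr1 ler_nat cr leq_mul2l; apply/orP; right.
  by rewrite leq_pexp2l// leq_mul2r ltn_ord orbT.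
pose N p := arc_size P (Lamb p).
have NLamb p : (4 * N p)%:R <= Lamb p by apply: arc_size_le => //; exact: ltW.
pose J p : finType := ('I_(N p) * 'I_(P ^ 2))%type.
pose Om := {p : Pi & J p}.
pose v1 p (i : J p) : T :=
  unit_vec (inord r) (h * (i.1 : nat)%:R) + unit_vec (inord r.+1) (h * (arc_height (Lamb p) i.1 + i.2)%:R).
pose v2 p (i : J p) : T :=
  unit_vec (inord r) (h * (i.1 : nat)%:R) + unit_vec (inord r.+1) (h * arc (Lamb p) i.1).
(* The exceptional positions, for which exactly one of the rounded end point, given by [v1], and the
   end point on the circle, given by [v2], lies in [A]. *)
pose Bd (w : Om) := symdiff (shifted (v1 _ (tagged w)) A) (shifted (v2 _ (tagged w)) A).
pose c (w : Om) : R := #|J (tag w)|%:R^-1.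
have mB w : mu.-caratheodory (Bd w).
  by apply: caratheodory_measurable_setU; apply: caratheodory_measurable_setD; exact: shifted_measurable.
have Be w : (mu (Bd w) <= eps%:E)%E.
  case: w => p [s t]; rewrite /Bd /= symdiff_shifted.
  have -> : v2 p (s, t) - v1 p (s, t) = unit_vec (inord r.+1) (h * (arc (Lamb p) s - (arc_height (Lamb p) s + t)%:R)).
    by rewrite /v1 /v2 /= /unit_vec mulrBr scalerBl opprD addrACA subrr add0r.
  apply: Heta; rewrite normrM gtr0_norm//.
  have /andP[y1 y2] := truncnE (arc_ge0 (Lamb p) s).
  have tP : (t : nat)%:R <= (P ^ 2)%:R :> R by rewrite ler_nat ltnW// ltn_ord.
  have t0 : 0 <= (t : nat)%:R :> R by rewrite ler0n.
  have small : `|arc (Lamb p) s - (arc_height (Lamb p) s + t)%:R| <= (1 + P ^ 2)%:R.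
    rewrite -/(arc_height (Lamb p) s) in y1 y2.
    by rewrite !natrD ler_norml; apply/andP; split; lra.
  apply: (@le_trans _ _ (h * (1 + P ^ 2)%:R)); first by rewrite ler_wpM2l// ltW.
  rewrite mulrC ler_pdivrMr// mulrC -ler_pdivrMr//; apply: le_trans W1 _.
  by rewrite ler_nat.
have c0 w : 0 <= c w by rewrite invr_ge0.
have sumc : \sum_w c w <= C0.
  rewrite sum_tagged /C0 -sum1_card natr_sum; apply: ler_sum => p _.
  rewrite /c /= sumr_const -[X in X <= _]mulr_natr.
  case: (posnP #|J p|) => [E|E]; first by rewrite E mulr0.
  by rewrite mulVf// pnatr_eq0 -lt0n.
have G0 : (0 < #|{: G}|)%N by apply/card_gt0P; exists 0.
pose lo : T := \row_(i < n.+1) (if (i < r.+2)%N then - K%:R else 0).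
have loL i : lo 0 i <= (const_mx L : T) 0 i.
  by rewrite !mxE; case: ifP => _; [have := ler0n R K; lra|exact: ltW].
have AV k : shifted (x k) A `<=` box lo (const_mx L).
  move=> t /AL tk i; have := tk i; rewrite !mxE; case: ifP => ir /andP[t1 t2].
    have k0 : 0 <= h * (k 0 (inord i) : nat)%:R by rewrite mulr_ge0// ltW.
    have kK : h * (k 0 (inord i) : nat)%:R <= K%:R.
      by rewrite -hH ler_wpM2l ?(ltW h0)// ler_nat ltnW// ltn_ord.
    by apply/andP; split; lra.
  by rewrite addr0 in t1 t2; rewrite t1 t2.
have Vv : (mu (box lo (const_mx L)) <= (5 ^+ r.+2 * L ^+ n.+1)%:E)%E.
  apply: le_trans (louter_box loL) _; rewrite lee_fin; apply: box_volume_slab => //.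
    exact: ltW.
  by rewrite ler0n.
have lt_a : 5 ^+ r.+2 * L ^+ n.+1 / Y%:R + (\sum_w c w) * eps / q < a.
  have YR : 0 < Y%:R :> R by rewrite ltr0n.
  have h1 : 5 ^+ r.+2 * L ^+ n.+1 / Y%:R <= a / 2.
    by rewrite ler_pdivrMr// [leRHS]mulrAC ler_pdivlMr//; lra.
  have h2 : (\sum_w c w) * eps / q <= C0 * eps / q.
    by rewrite ler_wpM2r ?invr_ge0 ?(ltW q0)// ler_wpM2r// ltW.
  have h3 : C0 * eps / q = a * (C0 / (4 * (C0 + 1))).
    rewrite /eps; field; rewrite !gt_eqF//; lra.
  have h4 : C0 / (4 * (C0 + 1)) <= 1 / 4.
    by rewrite ler_pdivrMr ?mulr_gt0//; lra.
  have : a * (C0 / (4 * (C0 + 1))) <= a * (1 / 4) by rewrite ler_wpM2l// ltW.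
  by lra.
have [t [GA Err]] := sampling mA mB c0 G0 Y0 q0 AV Vv Be Aa lt_a.
set At := [set k | _]%SET in GA.
pose g (i : nat) : G := gen H (inord i : 'I_r.+2).
pose u (i : 'I_r) : G := g i.
pose step s := (b ^ (S - s.+1) * W)%N.
have [s [j [sS ineq]]] := discrete_pattern u (g r) (g r.+1) step
  (ltac:(by rewrite cr) : (0 < #|'I_r|)%N) Y0 P1 D0 XS XP Xb GA.
pose p : Pi := (Ordinal sS, j).
have stepD : (step s * b ^ s.+1 = D)%N by rewrite /step mulnAC -expnD subnK.
have step0 : (0 < step s)%N by rewrite muln_gt0 expn_gt0 b0.
have stepL z : (z <= b)%N -> h * (step s * z)%:R < 2 * L.
  move=> zb; apply: (@le_lt_trans _ _ 1); last by lra.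
  apply: (@le_trans _ _ (h * D%:R)); last by rewrite hD.
  rewrite ler_wpM2l ?(ltW h0)// ler_nat -stepD leq_mul2l; apply/orP; right.
  by apply: leq_trans zb _; rewrite -[X in (X <= _)%N]expn1 leq_pexp2l.
apply: contrapT => none.
have key k i : indic R (corner_set u At (step s) j) k *
    indic R At (k + arc_shift (g r) (g r.+1) (Lamb p) i) <=
    \1_(Bd (Tagged J (i : J p))) (t + x k).
  rewrite /indic; case: (boolP (k \in _)) => [kB|_]; last by rewrite mul0r indicE.
  case: (boolP (_ \in At)) => [kA|_]; last by rewrite mulr0 indicE.
  rewrite mulr1 indicE mem_set//.
  move: kB kA; rewrite !inE => /andP[/asboolP Ak /forallP Bk] /asboolP Aki.
  have Lp0 := Lamb0 p; have Lp1 := hLamb p; have Np := NLamb p.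
  have iL : (i.1 : nat)%:R <= Lamb p.
    apply: le_trans Np; rewrite ler_nat; apply: (@leq_trans (N p)); last by rewrite leq_pmull.
    exact/ltnW/ltn_ord.
  have hi : h * (i.1 : nat)%:R < 2 * L.
    apply: (@le_lt_trans _ _ L); last by lra.
    by apply: le_trans Lp1; rewrite ler_wpM2l// ltW.
  have hy : h * (arc_height (Lamb p) i.1 + i.2)%:R < 2 * L.
    have y1 : (arc_height (Lamb p) i.1)%:R <= Lamb p.
      by have /andP[y _] := truncnE (arc_ge0 (Lamb p) i.1); apply: le_trans y (arc_le Lp0 _).
    have i2 : h * (i.2 : nat)%:R < 1.
      apply: (@lt_le_trans _ _ (h * D%:R)); last by rewrite hD.
      rewrite ltr_pM2l// ltr_nat; apply: leq_trans WD.
      by apply: leq_trans W2; rewrite ltnS ltnW// ltn_ord.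
    have : h * (arc_height (Lamb p) i.1)%:R <= h * Lamb p by rewrite ler_wpM2l// ltW.
    by rewrite natrD mulrDr; lra.
  rewrite /arc_shift /arc_point -(addrA (g r *+ _)) -mulrnDr in Aki.
  have {}Aki := asboolW Aki.
  have E1 := @lattice_shift_pair R n r H h rn H0 h0 L t k r r.+1 i.1 _
    (ltnW (ltnSn r.+1)) (ltnSn r.+1) (negbT (ltn_eqF (ltnSn r))) hH3 hi hy (AL _ Ak) (AL _ Aki).
  (* The rounded end point lies in [A]; if the one on the circle did too, it would complete a
     simplex of volume exactly 1. *)
  left; split; first by rewrite /shifted /= /v1 -E1.
  rewrite /shifted /= => A2; apply: none.
  pose ell := h * Lamb p.
  have ell0 : 0 < ell by rewrite mulr_gt0.
  have l0 i' : 0 < lengths (step s) h j i' by exact: lengths_gt0.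
  have ellE : (h * (i.1 : nat)%:R) ^+ 2 + (h * arc (Lamb p) i.1) ^+ 2 = ell ^+ 2.
    have E2 : arc (Lamb p) i.1 ^+ 2 = Lamb p ^+ 2 - (i.1 : nat)%:R ^+ 2.
      by rewrite /arc sqr_sqrtr// subr_ge0 ler_pXn2r ?nnegrE// ltW.
    have E3 (z1 z2 z3 : R) : z2 ^+ 2 = z3 ^+ 2 - z1 ^+ 2 -> (h * z1) ^+ 2 + (h * z2) ^+ 2 = (h * z3) ^+ 2.
      by move=> e; rewrite !exprMn e; ring.
    exact: E3 E2.
  exists (t + x k), (edges n r (lengths (step s) h j) (h * (i.1 : nat)%:R) (h * arc (Lamb p) i.1)).
  split.
  - exact: (edges_right_angled rn l0 ell0 ellE).
  - apply: (edges_volume rn l0 ell0 ellE).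
    exact: lengths_volume.
  - apply: (edges_vertices rn) => // i' i'r.
    pose i0 := Ordinal i'r; have := Bk i0; rewrite inE => /asboolP Bk0.
    rewrite -[i']/(val i0) lengthsE -(@lattice_shift_unit R n r H h rn H0 h0 L)//.
    + by rewrite ltnS ltnW// ltnW.
    + exact: ltW.
    + by apply: stepL; apply: leq_trans XbX; exact: ltn_ord.
    + exact: AL.
    + exact: AL.
  - exact: (edges_axis_adapted rn).
(* Of the total error only the part of the pair [p] is kept, the other terms being nonnegative. *)
have lower : (Xm^-1 / 2 * #|{: G}|%:R <= q * #|{: G}|%:R).
  apply: le_trans ineq _; apply: le_trans Err.
  rewrite sum_tagged (bigD1 p)//= -[leLHS]addr0; apply: lerD; last first.
    by apply: sumr_ge0 => p' _; apply: sumr_ge0 => i _; rewrite mulr_ge0// sumr_ge0// => k _; rewrite indicE.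
  rewrite /c /= -mulr_sumr.
  apply: (@le_trans _ _ (#|J p|%:R^-1 * \sum_(i : J p) \sum_k indic R (corner_set u At (step s) j) k *
    indic R At (k + arc_shift (g r) (g r.+1) (Lamb p) i))).
    rewrite exchange_big mulr_sumr /ip le_eqVlt; apply/orP; left; apply/eqP.
    by apply: eq_bigr => k _; rewrite /av mulrCA mulr_sumr.
  rewrite ler_wpM2l ?invr_ge0//; apply: ler_sum => i _.
  by apply: ler_sum => k _; exact: key.
move: lower; rewrite ler_pM2r ?ltr0n// /q.
have : 0 < Xm^-1 by rewrite invr_gt0.
lra.
Qed.

End DensePattern.

(** * Choice of the parameters *)

Section Final.
Variable R : realType.

Lemma le_expR (x : R) : x <= expR x.
Proof. by have := expR_ge1Dx x; lra. Qed.

(** With m = [k.+1]: the construction costs the power 4 m + 1 of 1 / density, and here it is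
    compared with the exponent of the theorem. *)
Lemma exponent_le (k : nat) : (4 * k.+1 + 1 <= 9 * k.+1 ^ 2)%N.
Proof. by rewrite -mulnn; nia. Qed.

Lemma sixth_power (q x k : nat) :
  (4 * (q * x ^ (4 * k)) ^ 6 * x = 4 * q ^ 6 * x ^ (24 * k + 1))%N.
Proof.
have E : (4 * k * 6 = 24 * k)%N by lia.
rewrite expnMn -expnM E addn1 (expnSr x); move: (expn q 6) (expn x (24 * k)) => u v.
by rewrite !mulnA.
Qed.

(* [P] and [S] are of order [X ^ (4 * m)] with [m = r.+1], and [b] is a power of [X], so
   [ln (b ^ (S * r))] is of order [X ^ (4 * m) * ln X], below [X ^ (9 * m ^ 2)]. *)
Lemma parameters (r : nat) : exists2 C : R, 0 < C & forall d : R, 0 < d <= 1 ->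
  exists Y P S b : nat, let X := (2 * #|'I_r| * Y)%N in
  [/\ (0 < Y)%N, 2 * 5 ^+ r.+2 <= Y%:R * d
    & (0 < r)%N ->
      [/\ (1 < P)%N, (32 * X ^ (4 * #|'I_r|.+1) <= S)%N,
      64 * 536 * (X ^ (4 * #|'I_r|.+1))%:R <= P%:R :> R,
      (4 * P ^ 6 * X <= b)%N
    & (r.+1`! * b ^ (S * r))%:R <= expR (C * d^-1 ^+ (9 * r.+1 ^ 2))]].
Proof.
rewrite card_ord.
have [Q Q0] : exists Q : nat, 64 * 536 <= Q%:R :> R.
  by exists (Num.truncn (64 * 536 : R)).+1; apply: ltW; exact: truncnS_gt.
have Q1 : (1 < Q)%N by rewrite -(ltr_nat R); apply: lt_le_trans Q0; lra.
pose e := (24 * r.+1 + 1)%N.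
(* The three constants serve for [ln b <= c2 * X], for [c3 * X ^ (4 * m + 1)] as a bound of the
   logarithm of the required side, and for [X <= c4 / d]. *)
pose c2 : R := (4 * Q ^ 6)%:R + e%:R.
pose c3 : R := (r.+1`!)%:R + 32 * r%:R * c2.
pose c4 : R := 2 * r%:R * (3 * 5 ^+ r.+2) + 1.
have c20 : 0 <= c2 by rewrite addr_ge0.
have c31 : 1 <= c3.
  by rewrite /c3 -[leLHS]addr0 lerD ?mulr_ge0// ler1n fact_gt0.
have p5 : 0 <= 5 ^+ r.+2 :> R by rewrite exprn_ge0.
have c41 : 1 <= c4 by rewrite /c4 lerDr; apply: mulr_ge0; rewrite mulr_ge0 ?ler0n.
exists (c3 * c4 ^+ (4 * r.+1 + 1)).
  by rewrite mulr_gt0 ?exprn_gt0//; lra.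
move=> d /andP[d0 d1].
(* The factor [5 ^+ r.+2] pays for the enlarged domain of the translations; the factor 2 reserves
   half of the measure for the rounding errors. *)
pose Y := (Num.truncn (2 * 5 ^+ r.+2 / d)).+1.
have Yd : 2 * 5 ^+ r.+2 <= Y%:R * d.
  by rewrite -ler_pdivrMr//; apply: ltW; exact: truncnS_gt.
have five : 1 <= 5 ^+ r.+2 :> R by rewrite exprn_ege1// ler1n.
have dV : 1 <= d^-1 by rewrite invf_ge1.
have Yu : Y%:R <= 3 * 5 ^+ r.+2 * d^-1.
  have q0 : 0 <= 2 * 5 ^+ r.+2 / d by apply: divr_ge0; [exact: mulr_ge0|exact: ltW].
  have /andP[h1 _] := truncnE q0.
  have z1 : 1 <= 5 ^+ r.+2 * d^-1 by exact: mulr_ege1.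
  have aux (u t : R) : 1 <= u * d^-1 -> t <= 2 * u / d -> t + 1 <= 3 * u * d^-1.
    by rewrite -!mulrA; set z := u * d^-1; lra.
  by rewrite /Y -[(Num.truncn _).+1%:R]natr1; exact: aux.
pose X := (2 * r * Y)%N.
pose P := (Q * X ^ (4 * r.+1))%N.
pose S := (32 * X ^ (4 * r.+1))%N.
pose b := (4 * P ^ 6 * X)%N.
exists Y, P, S, b; rewrite -/X; split=> // r0.
have X0 : (0 < X)%N by rewrite !muln_gt0 r0.
have XR : 1 <= X%:R :> R by rewrite ler1n.
split=> //.
- by apply: (@leq_trans Q) => //; rewrite leq_pmulr// expn_gt0 X0.
- by rewrite /P natrM ler_wpM2r.
have Xu : X%:R <= c4 * d^-1.
  apply: (@le_trans _ _ (2 * r%:R * (3 * 5 ^+ r.+2 * d^-1))).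
    by rewrite /X !natrM ler_wpM2l ?mulr_ge0.
  have aux (u v z : R) : 0 <= v -> u * (z * v) <= (u * z + 1) * v by move=> v0; lra.
  by apply: aux; rewrite invr_ge0 ltW.
have bE : (b = 4 * Q ^ 6 * X ^ e)%N by exact: sixth_power.
have b_le : b%:R <= expR (c2 * X%:R).
  rewrite bE natrM natrX; apply: (@le_trans _ _ (expR (4 * Q ^ 6)%:R * expR X%:R ^+ e)).
    apply: ler_pM => //; first exact: le_expR.
    by rewrite ler_pXn2r ?nnegrE ?expR_ge0// le_expR.
  rewrite -expRM_natl -expRD ler_expR /c2 mulrDl lerD2r.
  by rewrite ler_peMr.
have XS : 1 <= X%:R ^+ (4 * r.+1 + 1) :> R by rewrite exprn_ege1.
have step1 : (r.+1`! * b ^ (S * r))%:R <= expR (c3 * X%:R ^+ (4 * r.+1 + 1)).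
  rewrite natrM natrX /c3 mulrDl expRD; apply: ler_pM; rewrite ?exprn_ge0//.
    by apply: le_trans (le_expR _) _; rewrite ler_expR ler_peMr.
  apply: (@le_trans _ _ (expR (c2 * X%:R) ^+ (S * r))).
    by apply: lerXn2r; rewrite ?nnegrE ?expR_ge0.
  rewrite -expRM_natl ler_expR le_eqVlt; apply/orP; left; apply/eqP.
  have -> : (S * r)%:R = 32 * X%:R ^+ (4 * r.+1) * r%:R :> R by rewrite /S natrM (natrM _ 32) natrX.
  by rewrite exprD expr1; ring.
apply: le_trans step1 _; rewrite ler_expR -mulrA ler_wpM2l//; first by lra.
apply: (@le_trans _ _ ((c4 * d^-1) ^+ (4 * r.+1 + 1))).
  by rewrite ler_pXn2r ?nnegrE// mulr_ge0 ?invr_ge0 ?(ltW d0)//; lra.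
rewrite exprMn ler_wpM2l ?exprn_ge0//; first by lra.
apply: ler_weXn2l => //.
exact: exponent_le.
Qed.

(** The common source of both parts: a colouring in [k] colours is the case [d = 1 / k] for one of
    its classes. *)
Lemma dense_simplex (r : nat) : (0 < r)%N ->
  exists2 C : R, 0 < C & forall (n : nat) (L d : R) (A : set 'rV[R]_n.+1),
    (r.+2 <= n.+1)%N -> 1 <= L -> 0 < d <= 1 -> A `<=` cube n.+1 L ->
    (@louter R n).-caratheodory A -> ((d * L ^+ n.+1)%:E <= louter A)%E ->
    expR (C * d^-1 ^+ (9 * r.+1 ^ 2)) <= L -> has_simplex r.+1 A.
Proof.
move=> r0; have [C C0 HC] := parameters r; exists C => // n L d A rn L1 d01 AL mA dA CL.
have [Y [P [S [b [Y0 Yd /(_ r0)[P1 XS XP Xb bL]]]]]] := HC d d01.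
have /andP[d0 d1] := d01.
have cubeL : (louter (cube n.+1 L) < +oo)%E.
  apply: le_lt_trans (louter_box _) (ltry _) => i; rewrite !mxE; lra.
have Aoo : (louter A < +oo)%E.
  by apply: le_lt_trans cubeL; apply: le_outer_measure.
have fA : louter A \is a fin_num by rewrite ge0_fin_numE ?outer_measure_ge0.
have Ln : 0 < L ^+ n.+1 by rewrite exprn_gt0//; lra.
have dA' : d * L ^+ n.+1 <= fine (louter A) by rewrite -lee_fin fineK.
apply: (@dense_pattern R n r rn L (fine (louter A)) A Y P S b) => //.
- by rewrite fineK.
- by apply: lt_le_trans dA'; rewrite mulr_gt0.
- apply: (@le_trans _ _ (Y%:R * (d * L ^+ n.+1))); last by rewrite ler_wpM2l.
  by rewrite mulrA ler_wpM2r// ltW.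
- exact: le_trans bL CL.
Qed.

End Final.

Unset Implicit Arguments.

Theorem theorem1 (R : realType) (m : nat) (hm : (2 <= m)%N) :
  exists2 C : R, 0 < C & forall n : nat, (m + 1 <= n)%N ->
    (forall (L : R) (A : set 'rV[R]_n),
       1 < L ->
       A `<=` cube n L ->
       lebesgue_measurable A ->
       (((C / ln L) `^ (1 / (9 * m ^ 2)%:R))%:E
          <= lebesgue_outer A / (L ^+ n)%:E)%E ->
       exists (p : 'rV[R]_n) (E : 'M[R]_(m, n)),
         [/\ right_angled E,
             right_angled_volume E = 1,
             simplex_vertices p E `<=` A
           & axis_adapted E])
    /\
    (forall (L : R) (r : nat) (P : 'I_r -> set 'rV[R]_n),
       0 < L ->
       measurable_coloring (cube n L) P ->
       expR (C * r%:R ^+ (9 * m ^ 2)) <= L ->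
       exists (c : 'I_r) (p : 'rV[R]_n) (E : 'M[R]_(m, n)),
         [/\ right_angled E,
             right_angled_volume E = 1,
             simplex_vertices p E `<=` P c
           & axis_adapted E]).
Proof.
case: m hm => [//|m] m1; have m0 : (0 < m)%N by [].
have [C C0 HC] := dense_simplex R m0; exists C => // -[|n]; rewrite addn1 // => mn.
have K0 : (9 * m.+1 ^ 2)%:R != 0 :> R by rewrite pnatr_eq0 muln_eq0 expn_eq0.
split=> [L A L1 AL mA dens|L k P L0 [mP tP UP] CL].
- have L0 : 0 < L by lra.
  have lnL : 0 < ln L by exact: ln_gt0.
  have q0 : 0 < C / ln L by exact: divr_gt0.
  set d := _ `^ _ in dens.
  have d0 : 0 < d by exact: powR_gt0.
  have dK : d ^+ (9 * m.+1 ^ 2) = C / ln L.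
    by rewrite -powR_mulrn ?(ltW d0)// -powRrM div1r mulVf// powRr1// ltW.
  have Ln : 0 < L ^+ n.+1 by rewrite exprn_gt0.
  have cubeL : (louter A <= (L ^+ n.+1)%:E)%E.
    apply: le_trans (louter_mono AL) _; apply: le_trans (louter_box _) _ => [i|].
      by rewrite !mxE ltW.
    rewrite lee_fin /box_volume (eq_bigr (fun=> L)) ?prodr_const ?card_ord// => i _.
    by rewrite !mxE subr0.
  have fA : louter A \is a fin_num.
    by rewrite ge0_fin_numE ?louter_ge0// (le_lt_trans cubeL)// ltry.
  have dA : ((d * L ^+ n.+1)%:E <= louter A)%E.
    move: dens; rewrite -[lebesgue_outer A]/(louter A) -(fineK fA) inver gt_eqF// -EFinM !lee_fin.
    by rewrite ler_pdivlMr.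
  suff : has_simplex m.+1 A by [].
  apply: (HC n L d A) => //; first exact: ltW.
    rewrite d0 /= -(ler_pM2r Ln) mul1r -lee_fin; exact: le_trans dA cubeL.
  (* For this [d] the exponent [C * d^-1 ^+ (9 * m.+1 ^ 2)] equals [ln L]. *)
  by rewrite exprVn dK invf_div mulrCA divff ?gt_eqF// mulr1 lnK.
- have cubeP : \bigcup_c P c = cube n.+1 L by [].
  (* Without colours the classes could not cover the origin. *)
  have k0 : (0 < k)%N.
    case: k P mP tP UP CL cubeP => // P mP tP UP _ cubeP.
    have : (cube n.+1 L) (const_mx 0) by move=> i; rewrite !mxE lexx ltW.
    by rewrite -cubeP => -[[]].
  have kR : 0 < k%:R :> R by rewrite ltr0n.
  have L1 : 1 <= L.
    apply: (le_trans _ CL); rewrite -[leLHS]expR0 ler_expR.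
    by apply: mulr_ge0; [exact: ltW|exact: exprn_ge0].
  have Ln : 0 < L ^+ n.+1 by rewrite exprn_gt0.
  have sum : (louter (cube n.+1 L) <= \sum_(c < k) louter (P c))%E.
    rewrite -cubeP.
    pose F i := if insub i is Some c then P c else set0.
    have FE (c : 'I_k) : F c = P c by rewrite /F valK.
    rewrite (_ : \bigcup_c P c = \big[setU/set0]_(i < k) F i).
      apply: le_trans (outer_measure_subadditive _ _ _) _.
      by apply: lee_sum => c _; rewrite FE.
    rewrite -bigcup_mkord; apply/seteqP; split=> x.
      by move=> [c _ Pc]; exists c => //=; rewrite ?FE.
    by move=> [i /= ik]; rewrite -[i]/(val (Ordinal ik)) FE => Px; exists (Ordinal ik).
  (* Here the outer measure of the cube is needed from below, by [cube_volume]; elsewhere upper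
     bounds for boxes suffice. *)
  have [c big] : exists c, ((k%:R^-1 * L ^+ n.+1)%:E <= louter (P c))%E.
    apply: contrapT => none.
    have small c : (louter (P c) < (k%:R^-1 * L ^+ n.+1)%:E)%E.
      by rewrite ltNge; apply/negP => h; apply: none; exists c.
    have := le_trans (cube_volume n (ltW L0)) sum; apply/negP; rewrite -ltNge.
    have fP c : louter (P c) = (fine (louter (P c)))%:E.
      by rewrite fineK// ge0_fin_numE ?louter_ge0// (lt_trans (small c))// ltry.
    rewrite (eq_bigr (fun c => (fine (louter (P c)))%:E)) => [|c _]; last exact: fP.
    rewrite sumEFin lte_fin.
    have -> : L ^+ n.+1 = \sum_(c < k) (k%:R^-1 * L ^+ n.+1).
      by rewrite sumr_const card_ord -[RHS]mulr_natl mulrA divff ?mul1r// gt_eqF.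
    apply: ltr_sum; first by apply/hasP; exists (Ordinal k0); rewrite ?mem_index_enum.
    by move=> c _; rewrite -lte_fin -fP.
  exists c; suff : has_simplex m.+1 (P c) by [].
  apply: (HC n L k%:R^-1 (P c)) => //.
  - by rewrite invr_gt0 kR invf_le1// ler1n.
  - by rewrite -cubeP => x Px; exists c.
  - exact: mP.
  - by rewrite invrK.
Qed.
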